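(* Let $\mathcal{T}$ be a regular triangulation of $\Omega$, $\widehat{\mathcal{T}}$ an admissible refinement of $\mathcal{T}$, let $V(\mathcal{T})$, $V(\widehat{\mathcal{T}})$, $a_h$, $\Vert\bullet\Vert_h$ be as in the context, let $f\in L^2(\Omega)$, and let $u_h\in V(\mathcal{T})$ and $\widehat{u}_h\in V(\widehat{\mathcal{T}})$ be the discrete solutions, i.e. $$a_h(u_h,v_h)=\int_\Omega f v_h\,\mathrm{d}x\ \text{ for all } v_h\in V(\mathcal{T}),\qquad a_h(\widehat{u}_h,\widehat{v}_h)=\int_\Omega f \widehat{v}_h\,\mathrm{d}x\ \text{ for all } \widehat{v}_h\in V(\widehat{\mathcal{T}}).$$ Suppose that there is a linear operator $I_h:H^m_0(\Omega)+V(\widehat{\mathcal{T}})\to V(\mathcal{T})$ and a constant $\Lambda_1$ such that (C1) $\Vert \widehat{v}_h-I_h\widehat{v}_h\Vert_{L^2(T)}\le \Lambda_1 h_T^m\Vert D^m_{\mathrm{NC}}(\widehat{v}_h-I_h\widehat{v}_h)\Vert_{L^2(T)}$ for all $T\in\mathcal{T}$ and all $\widehat{v}_h\in V(\widehat{\mathcal{T}})$; (C2) $a_h(w_h,\widehat{v}_h-I_h\widehat{v}_h)=0$ for all $w_h\in V(\mathcal{T})$ and all $\widehat{v}_h\in V(\widehat{\mathcal{T}})$; (C3) $(\widehat{v}_h-I_h\widehat{v}_h)|_T=0$ for all $T\in\mathcal{T}\cap\widehat{\mathcal{T}}$ and all $\widehat{v}_h\in V(\widehat{\mathcal{T}})$;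 and let $\widehat{u}_h^*\in V(\widehat{\mathcal{T}})$ satisfy (C4) $I_h\widehat{u}_h^*=u_h$. Then $$\frac{2}{1+\sqrt2}\,\Vert\widehat{u}_h-u_h\Vert_h\le\Vert\widehat{u}_h^*-u_h\Vert_h+\Lambda_1\Vert h_{\mathcal{T}}^m f\Vert_{L^2(\mathcal{T}\setminus\widehat{\mathcal{T}})}.$$
   Context: $\Omega\subset\mathbb{R}^n$ is a bounded polyhedral Lipschitz domain. A regular triangulation is a triangulation into closed simplices in the sense of Ciarlet; $\widehat{\mathcal{T}}$ is a regular triangulation refining $\mathcal{T}$ (each $T\in\mathcal{T}$ is a union of simplices of $\widehat{\mathcal{T}}$). $\mathcal{T}\cap\widehat{\mathcal{T}}$ is the set of coarse simplices that are also fine simplices, $\mathcal{T}\setminus\widehat{\mathcal{T}}$ the set of coarse simplices that are not fine ones. $P_k(\mathcal{T})$ denotes the $\mathcal{T}$-piecewise polynomials of degree at most $k$. $V(\mathcal{T})\subset P_k(\mathcal{T})$ and $V(\widehat{\mathcal{T}})\subset P_k(\widehat{\mathcal{T}})$ are vector spaces; they need not be nested. $m\ge 1$ is an integer, $D^m_{\mathrm{NC}}$ denotes the piecewise action of the $m$-th derivative $D^m$ (gradient for $m=1$, Hessian for $m=2$), taken with respect to $\widehat{\mathcal{T}}$ for functions that are only $\widehat{\mathcal{T}}$-piecewise smooth. $a_h(v,w):=(D^m_{\mathrm{NC}}v,D^m_{\mathrm{NC}}w)_{L^2(\Omega)}$ is supposed to be a scalar product on $V(\mathcal{T})+V(\widehat{\mathcal{T}})$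 with induced norm $\Vert v\Vert_h=\big(\sum_{T\in\mathcal{T}}\Vert D^m_{\mathrm{NC}}v\Vert_{L^2(T)}^2\big)^{1/2}$. $h_T:=\mathrm{diam}(T)$, and $\Vert h_{\mathcal{T}}^m f\Vert_{L^2(\mathcal{T}\setminus\widehat{\mathcal{T}})}:=\big(\sum_{T\in\mathcal{T}\setminus\widehat{\mathcal{T}}}h_T^{2m}\Vert f\Vert_{L^2(T)}^2\big)^{1/2}$.
   Formalization: The constant Λ₁ is assumed to be nonnegative; for Λ₁ < 0 condition (C1) can hold with both sides zero (v̂_h = I_h v̂_h for all v̂_h) while the right-hand side of the claim is negative, so the claim fails. *)

(* Defs.v *)
From HB Require Import structures.
From mathcomp Require Import all_boot all_order all_algebra.
From mathcomp Require Import all_classical all_reals all_analysis.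
From mathcomp Require mpoly.
Set Implicit Arguments.
Unset Strict Implicit.
Unset Printing Implicit Defensive.
Import Order.TTheory GRing.Theory Num.Theory.
Import numFieldNormedType.Exports.
Local Open Scope classical_set_scope.
Local Open Scope ring_scope.

(* 'rV[R]_n carries the sigma-algebra generated by the coordinates, i.e. the
   Borel sigma-algebra of R^n. The Lebesgue measure lebesgue_rV n on it is the
   n-fold product of lebesgue_measure. *)
Section measurable_rV.
Context {R : realType} (n : nat).

Let coord (i : 'I_n) (x : 'rV[R]_n) : measurableTypeR R := x ord0 i.

Let rV_set0 : g_sigma_preimage coord set0.
Proof. exact: sigma_algebra0. Qed.

Let rV_setC A : g_sigma_preimage coord A -> g_sigma_preimage coord (~` A).
Proof. exact: sigma_algebraC. Qed.

Let rV_bigcup (F : _^nat) : (forall i, g_sigma_preimage coord (F i)) ->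
  g_sigma_preimage coord (\bigcup_i (F i)).
Proof. exact: sigma_algebra_bigcup. Qed.

HB.instance Definition _ :=
  @isMeasurable.Build
    (measure_tuple_display (sigma_display (R.-ocitv.-measurable))) 'rV[R]_n
    (g_sigma_preimage coord) rV_set0 rV_setC rV_bigcup.
End measurable_rV.

Section rV_cons.
Context {R : realType} (n : nat).

Definition rV_cons (p : measurableTypeR R * 'rV[R]_n) : 'rV[R]_n.+1 :=
  \row_i (if unlift ord0 i is Some j then p.2 ord0 j else p.1).

Definition rV_uncons (x : 'rV[R]_n.+1) : measurableTypeR R * 'rV[R]_n :=
  (x ord0 ord0, \row_i x ord0 (lift ord0 i)).

Lemma rV_cons0 p : rV_cons p ord0 ord0 = p.1.
Proof. by rewrite mxE unlift_none. Qed.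

Lemma rV_consS p i : rV_cons p ord0 (lift ord0 i) = p.2 ord0 i.
Proof. by rewrite mxE liftK. Qed.

Lemma measurable_coord (i : 'I_n) :
  measurable_fun setT (fun x : 'rV[R]_n => x ord0 i : measurableTypeR R).
Proof.
move=> _ Y mY; rewrite setTI; apply: sub_sigma_algebra => /=.
rewrite -bigcup_seq/=; exists i => /=; first by rewrite mem_index_enum.
by exists Y => //; rewrite setTI.
Qed.
End rV_cons.

Lemma measurable_fun_rVP {R : realType} n d (T : measurableType d)
    (f : T -> 'rV[R]_n) :
  (forall i, measurable_fun setT (fun x => f x ord0 i : measurableTypeR R)) ->
  measurable_fun setT f.
Proof.
move=> mf.
pose F (i : 'I_n) (x : 'rV[R]_n) : measurableTypeR R := x ord0 i.
have : g_sigma_preimage (fun i => F i \o f) `<=` measurable.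
  apply: smallest_sub; first exact: sigma_algebra_measurable.
  case: n => [|n] in f mf F *; first by rewrite big_ord0.
  rewrite -bigcup_mkord_ord; apply: bigcup_sub => i Ii.
  by move=> A [B mB <-]; exact: mf.
rewrite g_sigma_preimage_comp => h _ A mA.
by apply: h; exists A.
Qed.

Section rV_cons2.
Context {R : realType} (n : nat).

Lemma measurable_rV_cons : measurable_fun setT (@rV_cons R n).
Proof.
apply: measurable_fun_rVP => i; case: (unliftP ord0 i) => [j|] ->.
  rewrite (_ : (fun x => _) = (fun x : 'rV[R]_n => x ord0 j) \o snd).
    by apply: measurableT_comp => //; exact: measurable_coord.
  by apply/funext => x; rewrite rV_consS.
rewrite (_ : (fun x => _) = fst); first exact: measurable_fst.
by apply/funext => x; rewrite rV_cons0.
Qed.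

Lemma measurable_rV_uncons : measurable_fun setT (@rV_uncons R n).
Proof.
apply: measurable_fun_pair; first exact: measurable_coord.
apply: measurable_fun_rVP => i.
rewrite (_ : (fun x => _) = (fun x : 'rV[R]_n.+1 => x ord0 (lift ord0 i)));
  first exact: measurable_coord.
by apply/funext => x; rewrite mxE.
Qed.

Lemma rV_consK : cancel (@rV_cons R n) (@rV_uncons R n).
Proof.
case=> t x; rewrite /rV_uncons rV_cons0; congr pair.
by apply/rowP => i; rewrite mxE rV_consS.
Qed.

Variable mu : {sigma_finite_measure set 'rV[R]_n -> \bar R}.

Definition lebesgue_rVS : set 'rV[R]_n.+1 -> \bar R :=
  pushforward (lebesgue_measure \x mu)%E (@rV_cons R n).

Let lebesgue_rVS0 : lebesgue_rVS set0 = 0%E.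
Proof. by rewrite /lebesgue_rVS /pushforward preimage_set0 measure0. Qed.

Let lebesgue_rVS_ge0 A : (0 <= lebesgue_rVS A)%E.
Proof. by rewrite /lebesgue_rVS /pushforward; apply: measure_ge0. Qed.

Let lebesgue_rVS_sigma_additive : semi_sigma_additive lebesgue_rVS.
Proof.
exact: (@measure_semi_sigma_additive _ _ _
  (measure_function_pushforward__canonical__measure_function_Measure
    (lebesgue_measure \x mu)%E measurable_rV_cons)).
Qed.

HB.instance Definition _ := isMeasure.Build _ _ _ lebesgue_rVS
  lebesgue_rVS0 lebesgue_rVS_ge0 lebesgue_rVS_sigma_additive.

Let lebesgue_rVS_sigma_finite : sigma_finite setT lebesgue_rVS.
Proof.
have [F FT mF] : sigma_finite setT (lebesgue_measure \x mu)%E.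
  have /sigma_finiteP[F [TF ndF Foo]] :=
    sigma_finiteT [the sigma_finite_measure _ _ of @lebesgue_measure R].
  have /sigma_finiteP[G [TG ndG Goo]] := sigma_finiteT mu.
  exists (fun k => F k `*` G k).
    rewrite -setXTT TF TG predeqE => -[x y]; split.
      move=> [/= [k _ Fkx] [l _ Gly]]; exists (maxn k l) => //; split.
      - by move: x Fkx; exact/subsetPset/ndF/leq_maxl.
      - by move: y Gly; exact/subsetPset/ndG/leq_maxr.
    by move=> [k _ []/= ? ?]; split; exists k.
  move=> k; have [? ?] := Foo k; have [? ?] := Goo k.
  split; first exact: measurableX.
  by rewrite product_measure1E// lte_mul_pinfty// ge0_fin_numE.
exists (fun i => @rV_uncons R n @^-1` F i).
  by rewrite -preimage_bigcup -FT preimage_setT.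
move=> i; split.
  rewrite -[X in measurable X]setTI.
  by apply: measurable_rV_uncons => //; have [] := mF i.
rewrite /lebesgue_rVS /pushforward -comp_preimage.
rewrite (_ : _ \o _ = id) ?preimage_id; last by apply/funext; exact: rV_consK.
by have [] := mF i.
Qed.

HB.instance Definition _ := @Measure_isSigmaFinite.Build _ _ _ lebesgue_rVS
  lebesgue_rVS_sigma_finite.
End rV_cons2.

Fixpoint lebesgue_rV {R : realType} (n : nat) :
    {sigma_finite_measure set 'rV[R]_n -> \bar R} :=
  match n with
  | 0 => \d_(0 : 'rV[R]_0)
  | n'.+1 => lebesgue_rVS (lebesgue_rV n')
  end.

Lemma lebesgue_rVSE {R : realType} n (A : set 'rV[R]_n.+1) :
  lebesgue_rV n.+1 A =
  (lebesgue_measure \x lebesgue_rV n)%E (@rV_cons R n @^-1` A).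
Proof. by []. Qed.

Lemma lebesgue_rV_box {R : realType} n (a b : 'rV[R]_n) :
  (forall i, a ord0 i <= b ord0 i) ->
  lebesgue_rV n [set x : 'rV[R]_n | forall i, a ord0 i <= x ord0 i <= b ord0 i] =
  (\prod_(i < n) (b ord0 i - a ord0 i))%:E.
Proof.
elim: n => [|n IH] in a b * => ab.
  rewrite big_ord0 /= diracE mem_set//= => -[]//.
pose tl (x : 'rV[R]_n.+1) : 'rV[R]_n := \row_i x ord0 (lift ord0 i).
have E : @rV_cons R n @^-1` [set x : 'rV[R]_n.+1 | forall i, a ord0 i <= x ord0 i <= b ord0 i] = (`[a ord0 ord0, b ord0 ord0]%classic `*`
   [set x : 'rV[R]_n | forall i, tl a ord0 i <= x ord0 i <= tl b ord0 i]).
  rewrite predeqE => -[t x] /=; split.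
    move=> h; split; first by have := h ord0; rewrite rV_cons0 in_itv.
    by move=> i; rewrite !mxE; have := h (lift ord0 i); rewrite rV_consS.
  move=> [ht hx] i; case: (unliftP ord0 i) => [j|] ->.
    by rewrite rV_consS; have := hx j; rewrite !mxE.
  by rewrite rV_cons0; rewrite in_itv in ht.
have mB : measurable [set x : 'rV[R]_n | forall i, tl a ord0 i <= x ord0 i <= tl b ord0 i].
  rewrite (_ : mkset _ = \bigcap_(i in [set: 'I_n]) ((fun x : 'rV[R]_n => x ord0 i) @^-1` `[tl a ord0 i, tl b ord0 i]%classic)).
    apply: fin_bigcap_measurable => // i _.
    by rewrite -[X in measurable X]setTI; apply: measurable_coord.
  rewrite predeqE => x; split => [h i _|h i] /=; first by rewrite in_itv /=; exact: h.
  by have := h i I; rewrite /= in_itv.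
rewrite lebesgue_rVSE E product_measure1E//=; rewrite IH; last first.
  by move=> i; rewrite !mxE.
rewrite lebesgue_measure_itv /= lte_fin big_ord_recl.
have -> : \prod_(i < n) (tl b ord0 i - tl a ord0 i) =
  \prod_(i < n) (b ord0 (lift ord0 i) - a ord0 (lift ord0 i)).
  by apply: eq_bigr => i _; rewrite !mxE.
case: ltP => h; first by rewrite -EFinB -EFinM.
have -> : b ord0 ord0 = a ord0 ord0 by apply/le_anti; rewrite h ab.
by rewrite subrr mul0r mul0e.
Qed.

(* The canonical topology of 'rV[R]_n is that of the sup norm, which is the
   Euclidean one; lengths, in contrast, must be measured by enorm and not by
   the canonical norm. *)
Definition dotv {R : realType} {n : nat} (x y : 'rV[R]_n) : R :=
  \sum_(i < n) x ord0 i * y ord0 i.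

Definition enorm {R : realType} {n : nat} (x : 'rV[R]_n) : R :=
  Num.sqrt (dotv x x).

Definition ediam {R : realType} {n : nat} (A : set 'rV[R]_n) : R :=
  sup [set enorm (p.1 - p.2) | p in A `*` A].

Definition boundary {T : topologicalType} (A : set T) : set T :=
  closure A `\` interior A.

(* Near each boundary point and in suitable Cartesian coordinates, Om is the
   set of points above the graph of a Lipschitz function. Here nu is the unit
   vector of the last coordinate, and a function of the other coordinates is a
   function on R^n that is constant along nu. *)
Definition lipschitz_boundary {R : realType} {n : nat} (Om : set 'rV[R]_n) :=
  forall x, boundary Om x ->
  exists (nu : 'rV[R]_n) (r L : R) (g : 'rV[R]_n -> R),
    [/\ 0 < r, enorm nu = 1,
        forall y z, `|g y - g z| <= L * enorm (y - z),
        forall y t, g (y + t *: nu) = g y &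
        forall y, enorm (y - x) < r -> (Om y <-> g y < dotv y nu)].

Definition conv_hull {R : realType} {n N : nat} (a : 'I_N -> 'rV[R]_n) :
    set 'rV[R]_n :=
  [set x | exists l : 'I_N -> R,
    [/\ forall i, 0 <= l i, \sum_(i < N) l i = 1 &
        x = \sum_(i < N) l i *: a i]].

Definition flat_polytope {R : realType} {n : nat} (P : set 'rV[R]_n) :=
  (exists (N : nat) (a : 'I_N -> 'rV[R]_n), P = conv_hull a) /\
  (exists (nu : 'rV[R]_n) (c : R),
    nu != 0 /\ forall x, P x -> dotv x nu = c).

Definition polyhedral_boundary {R : realType} {n : nat} (Om : set 'rV[R]_n) :=
  exists F : set (set 'rV[R]_n),
    [/\ finite_set F, forall P, F P -> flat_polytope P &
        boundary Om = \bigcup_(P in F) P].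

Definition polyhedral_lipschitz_domain {R : realType} {n : nat}
    (Om : set 'rV[R]_n) :=
  [/\ open Om, connected Om, Om !=set0 & bounded_set Om] /\
  lipschitz_boundary Om /\ polyhedral_boundary Om.

Definition affinely_independent {R : realType} {n : nat}
    (a : 'I_n.+1 -> 'rV[R]_n) : bool :=
  (\matrix_(i < n) (a (lift ord0 i) - a ord0)) \in unitmx.

Definition is_simplex {R : realType} {n : nat} (T : set 'rV[R]_n) :=
  exists a : 'I_n.+1 -> 'rV[R]_n, affinely_independent a /\ T = conv_hull a.

Definition is_face {R : realType} {n : nat} (F T : set 'rV[R]_n) :=
  exists (a : 'I_n.+1 -> 'rV[R]_n) (j : 'I_n.+1),
    [/\ affinely_independent a, T = conv_hull a & F = conv_hull (a \o lift j)].

(* Ciarlet's conditions (T_h 1), (T_h 2), (T_h 3), (T_h 5) on a triangulation;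
   faces are (n-1)-dimensional, and (T_h 4) (Lipschitz boundaries) is automatic
   for simplices. *)
Definition regular_triangulation {R : realType} {n : nat} (Om : set 'rV[R]_n)
    (TT : set (set 'rV[R]_n)) :=
  [/\ finite_set TT,
      forall T, TT T -> is_simplex T,
      closure Om = \bigcup_(T in TT) T,
      forall T1 T2, TT T1 -> TT T2 -> T1 <> T2 ->
        interior T1 `&` interior T2 = set0 &
      forall T F, TT T -> is_face F T ->
        F `<=` boundary Om \/
        exists T', [/\ TT T', T' <> T & is_face F T']].

Definition refines {R : realType} {n : nat} (TTh TT : set (set 'rV[R]_n)) :=
  forall T, TT T -> T = \bigcup_(K in [set K | TTh K /\ K `<=` T]) K.

(* Elements of function spaces on Om are represented by Borel functions on
   R^n, of which only the values almost everywhere in Om matter. *)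
Section function_spaces.
Context {R : realType} {n : nat}.
Local Notation mu := (lebesgue_rV n).
Implicit Types (A Om : set 'rV[R]_n) (u v w f g : 'rV[R]_n -> R).

Definition L2 A f :=
  measurable_fun setT f /\ mu.-integrable A (fun x => (f x ^+ 2)%:E).

Definition L2norm A f : R := Num.sqrt (\int[mu]_(x in A) (f x ^+ 2)).

Definition pderiv (s : seq 'I_n) (f : 'rV[R]_n -> R) : 'rV[R]_n -> R :=
  foldr (fun i g x => 'D_(delta_mx ord0 i) g x) f s.

Definition test_function Om (phi : 'rV[R]_n -> R) :=
  [/\ forall s, continuous (pderiv s phi),
      forall s i x, derivable (pderiv s phi) x (delta_mx ord0 i),
      compact (closure [set x | phi x != 0]) &
      closure [set x | phi x != 0] `<=` Om].

Definition weak_pderiv Om (s : seq 'I_n) u g :=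
  forall phi, test_function Om phi ->
    \int[mu]_(x in Om) (u x * pderiv s phi x) =
    (-1) ^+ size s * \int[mu]_(x in Om) (g x * phi x).

Definition Hm (m : nat) Om : set ('rV[R]_n -> R) :=
  [set u | L2 Om u /\
    forall s : seq 'I_n, (size s <= m)%N ->
      exists g, L2 Om g /\ weak_pderiv Om s u g].

(* The closure of the test functions in the norm of H^m(Om) *)
Definition Hm0 (m : nat) Om : set ('rV[R]_n -> R) :=
  [set u | Hm m Om u /\
    exists phi : nat -> 'rV[R]_n -> R,
      (forall j, test_function Om (phi j)) /\
      forall (s : seq 'I_n) g, (size s <= m)%N ->
        L2 Om g -> weak_pderiv Om s u g ->
        L2norm Om (pderiv s (phi j) \- g) @[j --> \oo] --> (0 : R)].

Definition pw_poly (k : nat) (TT : set (set 'rV[R]_n)) :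
    set ('rV[R]_n -> R) :=
  [set v | measurable_fun setT v /\
    forall T, TT T -> exists p : mpoly.mpoly n R,
      all (fun al => (mpoly.mdeg al <= k)%N) (mpoly.msupp p) /\
      forall x, interior T x -> v x = mpoly.meval (fun i => x ord0 i) p].

Definition is_subspace (V : set ('rV[R]_n -> R)) :=
  V (cst 0) /\
  forall (a : R) v w, V v -> V w -> V (fun x => a * v x + w x).

Definition sum_space (V W : set ('rV[R]_n -> R)) : set ('rV[R]_n -> R) :=
  [set u | exists v w, [/\ V v, W w & u = v \+ w]].

Definition is_scalar_product Om (V : set ('rV[R]_n -> R))
    (a : ('rV[R]_n -> R) -> ('rV[R]_n -> R) -> R) :=
  [/\ forall v w, V v -> V w -> a v w = a w v,
      forall (c : R) u v w, V u -> V v -> V w ->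
        a (fun x => c * u x + v x) w = c * a u w + a v w,
      forall v, V v -> 0 <= a v v &
      forall v, V v -> a v v = 0 -> ae_eq mu Om v (cst 0)].

(* The second clause says that I_h acts on functions modulo equality almost
   everywhere. *)
Definition linear_operator Om (D V : set ('rV[R]_n -> R))
    (I_h : ('rV[R]_n -> R) -> ('rV[R]_n -> R)) :=
  [/\ forall v, D v -> V (I_h v),
      forall v w, D v -> D w -> ae_eq mu Om v w ->
        ae_eq mu Om (I_h v) (I_h w) &
      forall (c : R) v w, D v -> D w ->
        ae_eq mu Om (I_h (fun x => c * v x + w x))
          (fun x => c * I_h v x + I_h w x)].

(* The components of D^m_NC v with respect to TT are pw_pderiv TT s v, for s an
   m-tuple of directions. They are set to 0 on the skeleton of TT, a null set.
   Tensors of order m are paired by the Frobenius product. *)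
Definition pw_pderiv (TT : set (set 'rV[R]_n)) (s : seq 'I_n) v :
    'rV[R]_n -> R :=
  pderiv s v \_ (\bigcup_(T in TT) interior T).

Definition DNCdot (m : nat) TT v w (x : 'rV[R]_n) : R :=
  \sum_(s : m.-tuple 'I_n) pw_pderiv TT s v x * pw_pderiv TT s w x.

Definition DNCnorm (m : nat) TT A v : R :=
  Num.sqrt (\int[mu]_(x in A) DNCdot m TT v v x).

Definition a_h (m : nat) TTh Om v w : R :=
  \int[mu]_(x in Om) DNCdot m TTh v w x.

Definition norm_h (m : nat) (TT TTh : set (set 'rV[R]_n)) v : R :=
  Num.sqrt (\sum_(T \in TT) DNCnorm m TTh T v ^+ 2).

Definition discrete_solution (m : nat) TTh Om f (V : set ('rV[R]_n -> R)) u :=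
  V u /\
  forall v, V v -> a_h m TTh Om u v = \int[mu]_(x in Om) (f x * v x).

Definition weighted_norm (m : nat) (TT : set (set 'rV[R]_n)) f : R :=
  Num.sqrt (\sum_(T \in TT) ediam T ^+ (2 * m) * L2norm T f ^+ 2).

End function_spaces.

(* Main.v *)
Require Import Defs.
From HB Require Import structures.
From mathcomp Require Import all_boot all_order all_algebra.
From mathcomp Require Import all_classical all_reals all_analysis.
From mathcomp Require Import ring lra.
From mathcomp Require Import measurable_realfun.
From mathcomp Require mpoly.
Set Implicit Arguments.
Unset Strict Implicit.
Unset Printing Implicit Defensive.
Import Order.TTheory GRing.Theory Num.Theory.
Import numFieldNormedType.Exports.
Local Open Scope classical_set_scope.
Local Open Scope ring_scope.

(** Write x := uh - u, y := us - u and d := uh - us, so that y = x - d, and let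
    e := d - I_h d. Testing the fine problem with d and, thanks to C2, the coarse
    problem with I_h d gives a_h(x, d) = (f, e). By C3 the function e vanishes on
    the simplices that are not refined, so two applications of Cauchy-Schwarz and
    C1 yield (f, e) <= c |e|_h with c := L1 |h^m f| ([load_residual_bound]). By C2
    the function e is a_h-orthogonal to I_h d, whence |e|_h <= |d|_h
    ([scalar_product_residual]). Expanding |y|_h^2 = |x - d|_h^2,

      |x|_h^2 = |y|_h^2 + 2 a_h(x, d) - |d|_h^2
             <= |y|_h^2 + 2 c |d|_h - |d|_h^2 <= |y|_h^2 + c^2,

    hence |x|_h <= |y|_h + c, and the factor 2 / (1 + sqrt 2) is at most 1
    ([energy_estimate]).

    Two points need analysis. First, I_h is only known to map
    Hm0 + Vh into V, so I_h d belongs to V only because the zero function belongs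
    to Hm0. As Hm0 is described through all weak derivatives of a function, this
    is the uniqueness of weak derivatives, i.e. the fundamental lemma of the
    calculus of variations ([fundamental_lemma], [Hm0_cst0]). Bump functions are
    products of exp(-1/s) in the coordinates; multiplied by smooth approximations
    of indicators of orthants they remain test functions, which reduces the
    claim to a pi-system argument.

    Second, the energy a_h is an integral over Om whereas norms and data are sums
    over simplices. A simplex is an intersection of half-spaces
    ([simplex_halfspaces]) and hyperplanes are null ([hyperplane_null]), so Om and
    the interiors of the simplices agree up to a null set
    ([Rintegral_triangulation]). The integrands are bounded and measurable
    because a coarse piecewise polynomial is also piecewise polynomial on the
    fine triangulation ([pw_elementary_refines]) and polynomials have bounded
    derivatives on the domain ([pw_pderiv_bounded]). *)

(** * Cubes, open sets and the volume of bounded sets *)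

Section cubes.
Context {R : realType} {n : nat}.
Implicit Types (x c : 'rV[R]_n) (U : set 'rV[R]_n).

Definition ocube c (e : R) : set 'rV[R]_n :=
  [set x | forall i, `|x ord0 i - c ord0 i| < e].

Definition ccube c (e : R) : set 'rV[R]_n :=
  [set x | forall i, `|x ord0 i - c ord0 i| <= e].

Lemma open_ccube U x : open U -> U x ->
  exists2 e : R, 0 < e & ccube x e `<=` U.
Proof.
move=> oU Ux; have /nbhs_ballP[r /= r0 rU] : nbhs x U by exact: open_nbhs_nbhs.
exists (r / 2); first by rewrite divr_gt0.
move=> y yx; apply: rU; split => // i j; rewrite (ord1 i) /ball /= distrC.
by apply: le_lt_trans (yx j) _; rewrite ltr_pdivrMr// ltr_pMr// ltr1n.
Qed.

Definition rat_cube (p : 'rV[rat]_n * rat) : 'rV[R]_n * R :=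
  (map_mx ratr p.1, ratr p.2).

(** Cubes with rational centre and size form a countable base; countability
    makes open sets measurable and lets almost-everywhere statements be checked
    cube by cube. *)
Lemma open_rat_cube U x : open U -> U x ->
  exists p, [/\ ocube (rat_cube p).1 (rat_cube p).2 x &
    ccube (rat_cube p).1 (rat_cube p).2 `<=` U].
Proof.
move=> oU Ux; have [e e0 eU] := open_ccube oU Ux.
have [q qe] : exists q : rat, (0 : R) < ratr q < e / 2.
  have [|q] := @rat_in_itvoo R 0 (e / 2); first by rewrite divr_gt0.
  by rewrite in_itv /=; exists q.
have /andP[q0 q2] := qe.
have P i : exists r : rat, `|x ord0 i - ratr r| < ratr q.
  have [|r] := @rat_in_itvoo R (x ord0 i - ratr q) (x ord0 i + ratr q).
    by lra.
  rewrite in_itv /= => /andP[h1 h2]; exists r.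
  by rewrite ltr_norml; apply/andP; split; lra.
have [g gP] := choice P.
exists (\row_i g i, q); split => [i|y yc].
  by rewrite !mxE; exact: gP.
apply: eU => i; have := yc i; have := gP i; rewrite /= !mxE => h1 h2.
rewrite -(subrK (ratr (g i)) (y ord0 i)) -addrA (le_trans (ler_normD _ _))//.
rewrite [in X in _ + X]distrC.
by apply: (@le_trans _ _ (ratr q + ratr q)); [apply: lerD => //; exact: ltW|lra].
Qed.

Lemma measurable_coord_lt (i : 'I_n) (f : R -> R) (e : R) :
  continuous f -> measurable [set x : 'rV[R]_n | f (x ord0 i) < e].
Proof.
move=> cf; have -> : [set x : 'rV[R]_n | f (x ord0 i) < e] =
    (fun x : 'rV[R]_n => x ord0 i : measurableTypeR R) @^-1` (f @^-1` `]-oo, e[%classic).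
  by apply/seteqP; split => x /=; rewrite in_itv.
rewrite -[X in measurable X]setTI; apply: measurable_coord => //.
rewrite -[X in measurable X]setTI.
by apply: (continuous_measurable_fun cf) => //; exact: measurable_itv.
Qed.

Lemma measurable_ocube c e : measurable (ocube c e).
Proof.
have -> : ocube c e = \bigcap_(i in [set: 'I_n])
    [set x : 'rV[R]_n | `|x ord0 i - c ord0 i| < e].
  by apply/seteqP; split => x /= h i; [move=> _|]; exact: h.
apply: fin_bigcap_measurable => // i _.
apply: (@measurable_coord_lt i (fun t => `|t - c ord0 i|)).
by move=> t; apply: cvg_norm; apply: cvgB; [exact: cvg_id|exact: cvg_cst].
Qed.

Lemma open_measurable_rV U : open U -> measurable U.
Proof.
move=> oU.
pose F (p : 'rV[rat]_n * rat) : set 'rV[R]_n :=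
  if `[< ccube (rat_cube p).1 (rat_cube p).2 `<=` U >]
  then ocube (rat_cube p).1 (rat_cube p).2 else set0.
have -> : U = \bigcup_p F p.
  apply/seteqP; split => x.
    move=> /(open_rat_cube oU)[p [p1 p2]]; exists p => //.
    by rewrite /F; case: asboolP.
  move=> [p _]; rewrite /F; case: asboolP => // pU xp; apply: pU => i.
  exact: ltW (xp i).
apply: countable_bigcupT_measurable; first exact: countableP.
by move=> p; rewrite /F; case: ifP => _ //; exact: measurable_ocube.
Qed.

Lemma interior_measurable_rV (A : set 'rV[R]_n) : measurable (interior A).
Proof. by apply: open_measurable_rV; exact: open_interior. Qed.

Lemma closed_measurable_rV U : closed U -> measurable U.
Proof.
by move=> cU; rewrite -(setCK U); apply: measurableC; apply: open_measurable_rV;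
  rewrite openC.
Qed.

Lemma continuous_measurable_rV (f : 'rV[R]_n -> R) :
  continuous f -> measurable_fun setT f.
Proof.
move=> cf; apply: (measurability _ (RGenOInfty.measurableE R)) => //.
move=> A /= [_ [x ->] <-]; rewrite setTI; apply: open_measurable_rV.
by apply: open_comp => //; exact: interval_open.
Qed.

Local Notation mu := (lebesgue_rV n).

Lemma ccubeE c e : ccube c e =
  [set x : 'rV[R]_n | forall i, (c - const_mx e) ord0 i <= x ord0 i
     <= (c + const_mx e) ord0 i].
Proof.
apply/seteqP; split => x h i; have := h i; rewrite !mxE ler_norml;
  move=> /andP[h1 h2]; apply/andP; split; lra.
Qed.

Lemma lebesgue_ccube c e : 0 <= e -> mu (ccube c e) = ((e *+ 2) ^+ n)%:E.
Proof.
move=> e0; rewrite ccubeE lebesgue_rV_box; last by move=> i; rewrite !mxE; lra.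
congr EFin; rewrite -[in RHS](card_ord n) -prodr_const; apply: eq_bigr => i _.
by rewrite !mxE; lra.
Qed.

Lemma bounded_ccube U : bounded_set U -> exists2 M, 0 <= M & U `<=` ccube 0 M.
Proof.
move=> [M [_ MP]]; exists (`|M| + 1); first by rewrite addr_ge0.
move=> x Ux i; rewrite mxE subr0.
have := MP (`|M| + 1); rewrite (le_lt_trans (ler_norm _)) ?ltrDl// => /(_ isT _ Ux).
apply: le_trans; rewrite [leRHS]/Num.norm /= mx_normrE.
apply/bigmax_geP; right => /=.
by exists (ord0, i).
Qed.

Lemma measurable_ccube c e : measurable (ccube c e).
Proof.
have -> : ccube c e = \bigcap_(k in [set: nat]) ocube c (e + k.+1%:R^-1).
  apply/seteqP; split => x /= h.
    by move=> k _ i; rewrite (le_lt_trans (h i))// ltrDl.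
  move=> i; apply/ler_addgt0Pr => d d0.
  have [k kd] : exists k : nat, k.+1%:R^-1 < d.
    by exists (Num.truncn d^-1); rewrite invf_plt ?posrE// truncnS_gt.
  by rewrite (le_trans (ltW (h k I i)))// lerD2l ltW.
by apply: bigcapT_measurable => k; exact: measurable_ocube.
Qed.

Lemma bounded_lebesgue_fin U : measurable U -> bounded_set U -> (mu U < +oo)%E.
Proof.
move=> mU /bounded_ccube[M M0 UM].
apply: (@le_lt_trans _ _ (mu (ccube 0 M))); last first.
  by rewrite lebesgue_ccube// ltry.
by apply: le_measure => //; rewrite inE//; exact: measurable_ccube.
Qed.

(** A nonempty open set contains a cube of positive volume. *)
Lemma open_lebesgue0 U : open U -> mu U = 0%E -> U = set0.
Proof.
move=> oU U0; apply/seteqP; split => // x Ux.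
have [e e0 eU] := open_ccube oU Ux.
have : (mu (ccube x e) <= mu U)%E.
  apply: le_measure; rewrite ?inE//; first exact: measurable_ccube.
  exact: open_measurable_rV.
rewrite U0 lebesgue_ccube ?(ltW e0)// lee_fin leNgt exprn_gt0//.
by rewrite pmulrn_lgt0.
Qed.

End cubes.

(** * Hyperplanes and simplices *)

Lemma negligible_fin_bigcup {d} {T : measurableType d} {R : realType}
    (mu : {measure set T -> \bar R}) (I : choiceType) (D : set I)
    (F : I -> set T) :
  finite_set D -> (forall i, D i -> mu.-negligible (F i)) ->
  mu.-negligible (\bigcup_(i in D) F i).
Proof.
move=> finD DF; rewrite -bigsetU_fset_set// big_seq.
elim/big_ind : _ => [|A B A0 B0|i].
- exact: negligible_set0.
- exact: negligibleU.
- by rewrite in_fset_set// inE; exact: DF.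
Qed.

Section hyperplanes.
Context {R : realType}.

Lemma dotvE {n} (x y : 'rV[R]_n) : dotv x y = (x *m y^T) ord0 ord0.
Proof. by rewrite mxE; apply: eq_bigr => i _; rewrite mxE. Qed.

Lemma dotvBl {n} (x y z : 'rV[R]_n) : dotv (x - y) z = dotv x z - dotv y z.
Proof. by rewrite !dotvE mulmxBl !mxE. Qed.

Lemma continuous_dotv {n} (nu : 'rV[R]_n) : continuous (fun x => dotv x nu).
Proof.
rewrite /dotv; apply: continuous_big => [|i _ x]; first exact: add_continuous.
exact: (cvgM (@coord_continuous R 1 n ord0 i x) (cvg_cst _)).
Qed.

Lemma hyperplane_closed {n} (nu : 'rV[R]_n) c : closed [set x | dotv x nu = c].
Proof.
rewrite (_ : [set x | _] = (fun x => dotv x nu) @^-1` [set c])//.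
by apply: closed_comp => [x _|]; [exact: continuous_dotv|exact: closed_eq].
Qed.

(** Slice along the first coordinate: unless the normal is parallel to the
    first axis, every slice is a hyperplane of one dimension less; otherwise the
    set is a point times the whole remaining space. *)
Lemma hyperplane_null n (nu : 'rV[R]_n) c : nu != 0 ->
  lebesgue_rV n [set x | dotv x nu = c] = 0%E.
Proof.
elim: n => [|n IH] in nu c * => nu0; first by rewrite thinmx0 eqxx in nu0.
pose tl : 'rV[R]_n := \row_i nu ord0 (lift ord0 i).
have dotE t (y : 'rV[R]_n) : dotv (rV_cons (t, y)) nu = t * nu ord0 ord0 + dotv y tl.
  rewrite /dotv big_ord_recl rV_cons0; congr (_ + _).
  by apply: eq_bigr => i _; rewrite rV_consS mxE.
rewrite lebesgue_rVSE.
have [tl0|tl0] := eqVneq tl 0.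
  have nu00 : nu ord0 ord0 != 0.
    apply: contra_neq nu0 => h; apply/rowP => i; rewrite mxE.
    case: (unliftP ord0 i) => [j|] -> //.
    by have := congr1 (fun v : 'rV[R]_n => v ord0 j) tl0; rewrite !mxE.
  have -> : @rV_cons R n @^-1` [set x | dotv x nu = c] =
      [set c / nu ord0 ord0] `*` setT.
    apply/seteqP; split => -[t y] /=; rewrite dotE tl0 {1}/dotv big1 ?addr0; last first.
    - by move=> i _; rewrite mxE mulr0.
    - by move=> [-> _]; rewrite divfK.
    - by move=> i _; rewrite mxE mulr0.
    - by move=> <-; rewrite mulfK.
  rewrite product_measure1E//.
  by rewrite [X in (X * _)%E](lebesgue_measure_set1 (c / nu ord0 ord0)) mul0e.
rewrite /product_measure1 /=; apply: integral0_eq => t _ /=.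
rewrite -[RHS](IH tl (c - t * nu ord0 ord0))//; congr (lebesgue_rV n _).
apply/seteqP; split => y; rewrite /xsection /= inE /= dotE => h; lra.
Qed.

Lemma hyperplane_measurable {n} (nu : 'rV[R]_n) c :
  measurable [set x | dotv x nu = c].
Proof. by apply: closed_measurable_rV; exact: hyperplane_closed. Qed.

(** The inequalities say that the n + 1 barycentric coordinates are
    nonnegative. Those of the vertices 1, ..., n are the entries of
    (x - a 0) M^-1, where M has the rows a i - a 0; the remaining one is 1 minus
    their sum. A vanishing normal would contradict the invertibility of M. *)
Lemma simplex_halfspaces n (T : set 'rV[R]_n) : (0 < n)%N -> is_simplex T ->
  exists (nu : 'I_n.+1 -> 'rV[R]_n) (c : 'I_n.+1 -> R),
    (forall j, nu j != 0) /\ T = [set x | forall j, c j <= dotv x (nu j)].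
Proof.
move=> n0 [a [ai ->]].
pose M := \matrix_(i < n) (a (lift ord0 i) - a ord0).
have uM : M \in unitmx by exact: ai.
pose w i : 'rV[R]_n := (col i (invmx M))^T.
pose b (x : 'rV[R]_n) := (x - a ord0) *m invmx M.
have bE x i : b x ord0 i = dotv x (w i) - dotv (a ord0) (w i).
  by rewrite -dotvBl /b mxE; apply: eq_bigr => j _; rewrite !mxE.
pose nu j := if unlift ord0 j is Some i then w i else - \sum_i w i.
have sumE x : dotv x (\sum_i w i) = \sum_i dotv x (w i).
  by rewrite dotvE raddf_sum mulmx_sumr summxE; apply: eq_bigr => i _; rewrite dotvE.
have NE x y : dotv x (- y) = - dotv x y :> R.
  by rewrite !dotvE raddfN mulmxN mxE.
exists nu, (fun j => dotv (a ord0) (nu j) - (unlift ord0 j == None)%:R); split.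
  move=> j; rewrite /nu; case: (unliftP ord0 j) => [i|] _.
    apply/eqP => w0; have : (M *m invmx M) i i = 1 by rewrite mulmxV// mxE eqxx.
    rewrite mxE big1 => [/esym/eqP|k _]; first by rewrite oner_eq0.
    have := congr1 (fun v : 'rV[R]_n => v ord0 k) w0.
    by rewrite !mxE => ->; rewrite mulr0.
  rewrite oppr_eq0; apply/eqP => w0.
  have iM0 : invmx M *m (const_mx 1 : 'cV_n) = 0.
    apply/colP => k; rewrite mxE; have := congr1 (fun v : 'rV[R]_n => v ord0 k) w0.
    rewrite summxE !mxE => h; rewrite -[RHS]h; apply: eq_bigr => i _.
    by rewrite !mxE mulr1.
  have := congr1 (fun v : 'cV_n => v (Ordinal n0) ord0) (congr1 (mulmx M) iM0).
  by rewrite mulKVmx// mulmx0 !mxE => /eqP; rewrite oner_eq0.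
have iffb x : (forall j, dotv (a ord0) (nu j) - (unlift ord0 j == None)%:R
    <= dotv x (nu j)) <-> (forall i, 0 <= b x ord0 i) /\ \sum_i b x ord0 i <= 1.
  split=> [h|[h1 h2] j].
    split=> [i|]; first by have := h (lift ord0 i); rewrite /nu liftK bE /=; lra.
    have := h ord0; rewrite /nu unlift_none eqxx !NE !sumE.
    by under [in X in _ -> X]eq_bigr do rewrite bE; rewrite sumrB /=; lra.
  rewrite /nu; case: (unliftP ord0 j) => [i|] _.
    by have := h1 i; rewrite bE /=; lra.
  move: h2; under eq_bigr do rewrite bE.
  by rewrite sumrB eqxx !NE !sumE /=; lra.
apply/seteqP; split => x /=; rewrite iffb.
  move=> [l [l0 l1 xE]].
  have bl i : b x ord0 i = l (lift ord0 i).
    have -> : b x = (\row_i l (lift ord0 i)); last by rewrite mxE.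
    rewrite /b -[RHS](mulmxK uM); congr (_ *m _).
    have -> : a ord0 = (\sum_i l i) *: a ord0 by rewrite l1 scale1r.
    rewrite xE scaler_suml -sumrB [LHS]big_ord_recl subrr add0r mulmx_sum_row.
    by apply: eq_bigr => k _; rewrite mxE rowK scalerBr.
  split=> [i|]; first by rewrite bl.
  under eq_bigr do rewrite bl.
  by rewrite -l1 big_ord_recl lerDr.
move=> [b0 b1].
exists (fun j => if unlift ord0 j is Some i then b x ord0 i else 1 - \sum_i b x ord0 i).
have E i : (if unlift ord0 (lift ord0 i) is Some i then b x ord0 i
    else 1 - \sum_i b x ord0 i) = b x ord0 i :> R by rewrite liftK.
split => [j||].
- by case: (unlift ord0 j) => // ; rewrite subr_ge0.
- by rewrite big_ord_recl unlift_none; under [X in _ + X]eq_bigr do rewrite E; rewrite subrK.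
rewrite big_ord_recl unlift_none; under [X in _ + X]eq_bigr do rewrite E.
have h : \sum_i b x ord0 i *: a (lift ord0 i) - (\sum_i b x ord0 i) *: a ord0
    = x - a ord0.
  rewrite -[RHS](mulmxKV uM) -/(b x) mulmx_sum_row scaler_suml -sumrB.
  by apply: eq_bigr => i _; rewrite rowK scalerBr.
by rewrite scalerBl scale1r addrAC -addrA h addrC subrK.
Qed.

Section simplex.
Context {n : nat} (n0 : (0 < n)%N) (T : set 'rV[R]_n) (sT : is_simplex T).

Lemma simplex_closed : closed T.
Proof.
have [nu [c [_ ->]]] := simplex_halfspaces n0 sT.
have -> : [set x | forall j, c j <= dotv x (nu j)] =
    \bigcap_j ((fun x => dotv x (nu j)) @^-1` [set y | c j <= y]).
  by apply/seteqP; split => x h j; [move=> _|]; exact: (h j).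
apply: closed_bigI => j _; apply: closed_comp => [x _|].
  exact: continuous_dotv.
exact: closed_ge.
Qed.

Lemma simplex_measurable : measurable T.
Proof. by apply: closed_measurable_rV; exact: simplex_closed. Qed.

(** A point at which all the inequalities are strict is interior, so the
    boundary lies in the finitely many hyperplanes where one is an equality. *)
Lemma simplex_boundary_negligible : (lebesgue_rV n).-negligible (T `\` interior T).
Proof.
have [nu [c [nu0 TE]]] := simplex_halfspaces n0 sT.
have sub : T `\` interior T `<=` \bigcup_j [set x | dotv x (nu j) = c j].
  move=> x [Tx iTx]; apply: contrapT => nx; apply: iTx.
  have : \forall y \near x, forall j, c j < dotv y (nu j).
    apply: (@filter_forall _ (fintype_ordinal__canonical__fintype_Finite n.+1)
      (fun j y => c j < dotv y (nu j)) (nbhs x)) => j.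
    have : c j < dotv x (nu j).
      rewrite lt_neqAle; apply/andP; split; last by move: Tx; rewrite TE; exact.
      by apply/eqP => cj; apply: nx; exists j.
    exact: (cvgr_gt _ (@continuous_dotv _ (nu j) x)).
  by apply: filterS => y yP; rewrite TE => j; exact: ltW.
apply: negligibleS sub _; apply: negligible_fin_bigcup.
  exact: finite_finset.
by move=> j _; apply/negligibleP; [exact: hyperplane_measurable|exact: hyperplane_null].
Qed.

End simplex.
End hyperplanes.

(** * Integration up to null sets and Cauchy-Schwarz *)

(** The discriminant form of Cauchy-Schwarz, shared by the versions for sums
    and for integrals. *)
Lemma discr_le {R : realType} (A B C : R) : 0 <= A -> 0 <= C ->
  (forall t, 0 <= A * t ^+ 2 - 2 * B * t + C) -> B <= Num.sqrt A * Num.sqrt C.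
Proof.
move=> A0 C0 P; rewrite -sqrtrM//.
have [B0|B0] := leP B 0; first by rewrite (le_trans B0)// sqrtr_ge0.
rewrite -[leLHS](ger0_norm (ltW B0)) -sqrtr_sqr ler_wsqrtr//.
have [A00|An0] := eqVneq A 0.
  have := P ((C + 1) / (2 * B)); rewrite A00 mul0r add0r mulrCA divff.
    by rewrite mulr1; lra.
  by rewrite mulf_neq0 ?gt_eqF.
have Ap : 0 < A by rewrite lt_neqAle eq_sym An0.
have := P (B / A).
have -> : A * (B / A) ^+ 2 - 2 * B * (B / A) + C = (A * C - B ^+ 2) / A by field.
by rewrite pmulr_lge0 ?invr_gt0// subr_ge0.
Qed.

Lemma sum_CS {R : realType} {I : Type} (s : seq I) (a b : I -> R) :
  \sum_(i <- s) a i * b i <=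
  Num.sqrt (\sum_(i <- s) a i ^+ 2) * Num.sqrt (\sum_(i <- s) b i ^+ 2).
Proof.
apply: discr_le => [||t]; [by apply: sumr_ge0 => i _; exact: sqr_ge0..|].
have -> : (\sum_(i <- s) a i ^+ 2) * t ^+ 2 - 2 * (\sum_(i <- s) a i * b i) * t +
    \sum_(i <- s) b i ^+ 2 = \sum_(i <- s) (a i * t - b i) ^+ 2.
  rewrite mulr_suml mulr_sumr mulr_suml -sumrB -big_split /=.
  by apply: eq_bigr => i _; ring.
by apply: sumr_ge0 => i _; exact: sqr_ge0.
Qed.

Lemma measurable_fun_fin_bigcup {d d'} {T : measurableType d} {U : measurableType d'}
    (I : choiceType) (D : set I) (F : I -> set T) (f : T -> U) :
  finite_set D -> (forall i, D i -> measurable (F i)) ->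
  (forall i, D i -> measurable_fun (F i) f) ->
  measurable_fun (\bigcup_(i in D) F i) f.
Proof.
move=> finD mF mf mDF Y mY; rewrite setI_bigcupl.
by apply: fin_bigcup_measurable => // i Di; apply: mf => //; exact: mF.
Qed.

Section integration.
Context {d} {T : measurableType d} {R : realType} (mu : {measure set T -> \bar R}).
Implicit Types (D E : set T).

(** Integrals over the domain, over the closed simplices and over their
    interiors are exchanged by this lemma, these sets being equal up to null
    sets. *)
Lemma integral_negl D E (f : T -> \bar R) : measurable D -> measurable E ->
  mu.-negligible (D `\` E) -> mu.-negligible (E `\` D) ->
  measurable_fun setT f -> (\int[mu]_(x in D) f x = \int[mu]_(x in E) f x)%E.
Proof.
move=> mD mE DE ED mf; rewrite integral_mkcond [RHS]integral_mkcond.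
apply: ae_eq_integral => //.
- by apply/(measurable_restrictT _ _).1 => //; exact: measurable_funTS.
- by apply/(measurable_restrictT _ _).1 => //; exact: measurable_funTS.
apply: negligibleS (negligibleU DE ED) => x /=; apply: contra_notP.
move=> /not_orP[h1 h2] _; rewrite !patchE.
case: ifPn; case: ifPn => //; rewrite ?inE ?notin_setE => a b.
- by exfalso; apply: h1.
- by exfalso; apply: h2.
Qed.

Lemma integrable_negl D E (f : T -> \bar R) : measurable D -> measurable E ->
  mu.-negligible (D `\` E) -> mu.-negligible (E `\` D) ->
  measurable_fun setT f -> mu.-integrable D f -> mu.-integrable E f.
Proof.
move=> mD mE DE ED mf /integrableP[_ fi]; apply/integrableP; split.
  exact: measurable_funTS.
by rewrite (integral_negl mE mD)//; exact: measurableT_comp.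
Qed.

Lemma Rintegral_negl D E (f : T -> R) : measurable D -> measurable E ->
  mu.-negligible (D `\` E) -> mu.-negligible (E `\` D) ->
  measurable_fun setT f -> \int[mu]_(x in D) f x = \int[mu]_(x in E) f x.
Proof.
move=> mD mE DE ED mf; rewrite /Rintegral (integral_negl mD mE)//.
exact/measurable_EFinP.
Qed.

Lemma Rintegral_fin_bigcup (I : choiceType) (A : set I) (F : I -> set T) (f : T -> R) :
  finite_set A -> (forall i, measurable (F i)) -> trivIset A F ->
  mu.-integrable (\bigcup_(i in A) F i) (EFin \o f) ->
  \int[mu]_(x in \bigcup_(i in A) F i) f x = \sum_(i \in A) \int[mu]_(x in F i) f x.
Proof.
move=> finA mF tF fi; rewrite fsbig_finite//= /Rintegral.
rewrite -(bigsetU_fset_set F finA) integral_bigsetU_EFin//.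
- rewrite [RHS]big_seq_cond [in LHS]big_seq_cond sum_fine// => i.
  rewrite andbT in_fset_set// inE => Ai.
  suff fFi : mu.-integrable (F i) (EFin \o f) by exact: (integrable_fin_num (mF i) fFi).
  apply: integrableS fi => //; last exact: bigcup_sup.
  by apply: fin_bigcup_measurable => // j _.
- by rewrite fset_setK.
- by rewrite bigsetU_fset_set//; exact: (measurable_int mu).
Qed.

Lemma integrable_mul D (f g : T -> R) : measurable D ->
  measurable_fun D f -> measurable_fun D g ->
  mu.-integrable D (fun x => (f x ^+ 2)%:E) ->
  mu.-integrable D (fun x => (g x ^+ 2)%:E) ->
  mu.-integrable D (EFin \o (f \* g)).
Proof.
move=> mD mf mg fi gi; apply: le_integrable (integrableD mD fi gi) => //.
  by apply/measurable_EFinP; exact: measurable_funM.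
move=> x Dx /=; rewrite lee_fin normrM [leRHS]ger0_norm ?addr_ge0 ?sqr_ge0//.
rewrite -(real_normK (num_real (f x))) -(real_normK (num_real (g x))).
have := sqr_ge0 (`|f x| - `|g x|); have := normr_ge0 (f x); have := normr_ge0 (g x).
nra.
Qed.

Lemma integral_CS D (f g : T -> R) : measurable D ->
  measurable_fun D f -> measurable_fun D g ->
  mu.-integrable D (fun x => (f x ^+ 2)%:E) ->
  mu.-integrable D (fun x => (g x ^+ 2)%:E) ->
  \int[mu]_(x in D) (f x * g x) <=
  Num.sqrt (\int[mu]_(x in D) (f x ^+ 2)) * Num.sqrt (\int[mu]_(x in D) (g x ^+ 2)).
Proof.
move=> mD mf mg fi gi; have fgi := integrable_mul mD mf mg fi gi.
apply: discr_le => [||t]; [by apply: Rintegral_ge0 => x _; exact: sqr_ge0..|].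
have -> : (\int[mu]_(x in D) f x ^+ 2) * t ^+ 2 -
    2 * (\int[mu]_(x in D) (f x * g x)) * t + \int[mu]_(x in D) g x ^+ 2 =
    \int[mu]_(x in D) (f x * t - g x) ^+ 2.
  have E x : D x -> (f x * t - g x) ^+ 2 = (t ^+ 2 * f x ^+ 2 + (- 2 * t) * (f x * g x)) + g x ^+ 2.
    by move=> _; ring.
  have i1 : mu.-integrable D (EFin \o (fun x => t ^+ 2 * f x ^+ 2)).
    exact: (integrableZl mD (t ^+ 2) fi).
  have i2 : mu.-integrable D (EFin \o (fun x => (- 2 * t) * (f x * g x))).
    exact: (integrableZl mD (- 2 * t) fgi).
  have -> : \int[mu]_(x in D) (f x * t - g x) ^+ 2 = \int[mu]_(x in D)
      ((t ^+ 2 * f x ^+ 2 + (- 2 * t) * (f x * g x)) + g x ^+ 2).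
    by apply: eq_Rintegral => x /set_mem; exact: E.
  rewrite RintegralD//; last exact: (integrableD mD i1 i2).
  by rewrite RintegralD// RintegralZl// RintegralZl//; ring.
by apply: Rintegral_ge0 => x _; exact: sqr_ge0.
Qed.

Lemma ae_eq0_Rintegral D (f : T -> R) : measurable D -> measurable_fun D f ->
  ae_eq mu D f (cst 0) -> \int[mu]_(x in D) f x = 0.
Proof.
move=> mD mf f0; rewrite /Rintegral (@ae_eq_integral _ _ _ mu D (cst 0%E))//.
- by rewrite integral_cst// mul0e.
- exact/measurable_EFinP.
- by apply: filterS f0 => x /[apply] /= ->.
Qed.

End integration.

(** * A flat function of one variable *)

Section flat.
Context {R : realType}.
Implicit Types (k : nat) (s : R).

(** All derivatives of exp(-1/s), extended by 0, are linear combinations of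
    these functions. *)
Definition flat k s : R := if 0 < s then s^-1 ^+ k * expR (- s^-1) else 0.

Lemma flat_ge0 k s : 0 <= flat k s.
Proof.
by rewrite /flat; case: ifP => // s0; rewrite mulr_ge0 ?expR_ge0 ?exprn_ge0 ?invr_ge0 ?ltW.
Qed.

Lemma flat0_le1 s : flat 0 s <= 1.
Proof.
rewrite /flat; case: ifP => // s0; rewrite expr0 mul1r -expR0 ler_expR oppr_le0.
by rewrite invr_ge0 ltW.
Qed.

Lemma flat0_gt0 s : (0 < flat 0 s) = (0 < s).
Proof. by rewrite /flat; case: ifP => _; rewrite ?ltxx// expr0 mul1r expR_gt0. Qed.

Lemma flat0_neq0 s : (flat 0 s != 0) = (0 < s).
Proof. by rewrite -flat0_gt0 [RHS]lt0r flat_ge0 andbT. Qed.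

(** From exp y >= (y / (k + 1)) ^ (k + 1) at y = 1/s. Since
    flat k s / s = flat k.+1 s, the bound for k + 1 is what makes flat k
    differentiable at 0. *)
Lemma flat_linear_bound k : exists2 C : R, 0 < C & forall s, `|flat k s| <= C * `|s|.
Proof.
exists (k.+1%:R ^+ k.+1); first by rewrite exprn_gt0.
move=> s; rewrite ger0_norm ?flat_ge0// /flat.
case: ifP => s0; last by rewrite mulr_ge0 ?exprn_ge0.
have y0 : 0 < s^-1 by rewrite invr_gt0.
rewrite (gtr0_norm s0) -[X in _ <= _ * X]invrK; set y := s^-1 in y0 *.
rewrite ler_pdivlMr// mulrAC -exprSr expRN ler_pdivrMr ?expR_gt0//.
rewrite -{2}[y](@divfK _ k.+1%:R) ?pnatr_eq0// [in expR _]mulrC expRM_natl -exprMn.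
rewrite ler_pXn2r// ?nnegrE ?mulr_ge0 ?expR_ge0 ?(ltW y0)//.
rewrite -ler_pdivrMl// mulrC; apply: le_trans (expR_ge1Dx _).
by rewrite lerDr.
Qed.

Lemma is_derive_flat k s :
  is_derive s 1 (flat k) (flat k.+2 s - k%:R * flat k.+1 s).
Proof.
have [s0|s0|->] := ltgtP s 0.
- have -> : flat k.+2 s - k%:R * flat k.+1 s = 0.
    by rewrite /flat ltNge (ltW s0) /= mulr0 subrr.
  apply: (@near_eq_is_derive _ _ _ (cst 0)).
  have := lt_nbhsl s0; apply: filterS => t t0; rewrite /flat.
  by rewrite ltNge (ltW t0).
- pose g (t : R) : R := t^-1.
  have dg : is_derive s 1 g (- s ^- 2).
    have H := @is_deriveV R id s 1 1 (lt0r_neq0 s0) (is_derive_id _ _).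
    by apply: (is_derive_eq H); rewrite [_ *: _]mulr1.
  have dgk := @is_deriveX _ _ g k s 1 _ dg.
  have dN := is_deriveN dg.
  have de := @is_derive1_comp _ expR (- g) s _ _ (is_derive_expR _) dN.
  have dM := is_deriveM dgk de.
  apply: (@near_eq_is_derive _ _ _ ((g ^+ k) * (expR \o (- g)))).
    have := lt_nbhsr s0; apply: filterS => t t0; rewrite /flat t0.
    by rewrite /g !fctE.
  apply: (is_derive_eq dM); rewrite /flat s0.
  rewrite !fctE /g /= /GRing.scale /=.
  case: (k) => [|k'] /=; rewrite ?exprS ?expr0; field; rewrite ?lt0r_neq0//.
  (* at 0 the difference quotient is flat k.+1 or 0, hence O(h) *)
- have -> : flat k.+2 0 - k%:R * flat k.+1 0 = 0 :> R.
    by rewrite /flat ltxx /= mulr0 subrr.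
  have [C C0 hC] := flat_linear_bound k.+1.
  suff H : (fun h => h^-1 *: ((flat k \o shift 0) (h *: 1) - flat k 0)) @ 0^' --> (0 : R).
    by split; [apply/cvg_ex; exists 0|exact/cvg_lim].
  have cC : (fun h : R => C * `|h|) @ 0^' --> (0 : R).
    have cC : C * `|h| @[h --> (0 : R)] --> C * `|0 : R|.
      by apply: cvgM; [exact: cvg_cst|apply: cvg_norm; exact: cvg_id].
    rewrite normr0 mulr0 in cC.
    by apply: cvg_trans cC; apply: cvg_app; exact: cvg_within.
  apply/norm_cvg0P.
  apply: (@squeeze_cvgr _ _ _ _ (cst 0) (fun h : R => C * `|h|)) => //.
    near=> h; apply/andP; split; first exact: normr_ge0.
    have h0 : h != 0 by near: h; exact: nbhs_dnbhs_neq.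
    rewrite /= addr0 [h *: 1]mulr1 {2}/flat ltxx subr0.
    apply: le_trans (hC h); rewrite /flat; case: ifP => h1; last by rewrite scaler0 normr0.
    by rewrite exprS -mulrA.
  exact: cvg_cst.
Unshelve. all: by end_near. Qed.

End flat.

(** * A class of smooth functions *)

Section elementary.
Context {R : realType} {n : nat}.
Implicit Types (f g : 'rV[R]_n -> R).

(** A class of smooth functions that contains both the polynomials and the bump
    functions needed below. Being closed under partial derivatives, it yields
    smoothness from the mere continuity and differentiability of its members,
    without a Leibniz rule of higher order. *)
Inductive elementary : ('rV[R]_n -> R) -> Prop :=
| elementary_cst c : elementary (fun=> c)
| elementary_coord i : elementary (fun x => x ord0 i)
| elementary_flat k (c b : R) i : elementary (fun x => flat k (c * x ord0 i + b))
| elementary_add f g : elementary f -> elementary g ->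
    elementary (fun x => f x + g x)
| elementary_mul f g : elementary f -> elementary g ->
    elementary (fun x => f x * g x).

(** Along the line through x in direction v the function is phi composed with
    an affine function of one variable. *)
Lemma is_derive_affine_coord (phi : R -> R) (c b d : R) i (x v : 'rV[R]_n) :
  is_derive (c * x ord0 i + b) 1 phi d ->
  is_derive x v (fun y => phi (c * y ord0 i + b)) (c * v ord0 i * d).
Proof.
move=> dphi.
pose l (h : R) := (c * v ord0 i) * h + (c * x ord0 i + b).
have dl : is_derive (0 : R) (1 : R) l (c * v ord0 i).
  have H := is_deriveD (is_deriveZ (c * v ord0 i) (is_derive_id (0 : R) (1 : R)))
    (is_derive_cst (c * x ord0 i + b) (0 : R) (1 : R)).
  by apply: (is_derive_eq H); rewrite addr0 [_ *: _]mulr1.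
have dl0 : is_derive (l 0) (1 : R) phi d by rewrite /l mulr0 add0r.
have D := is_derive1_comp dl0 dl.
have E : (fun h : R => phi (c * (h *: v + x) ord0 i + b)) = phi \o l.
  by apply/funext => h; rewrite /= /l !mxE; congr phi; ring.
have D' : is_derive x v (fun y => phi (c * y ord0 i + b)) ('D_1 (phi \o l) 0).
  split; first by apply: (derivable1P _ _ _).2; rewrite E; case: D.
  rewrite -E /derive; set d1 := (fun h : R => h^-1 *: ((_ \o shift x) _ - _)).
  set d2 := (fun h : R => h^-1 *: ((_ \o shift 0) _ - _)).
  suff -> : d1 = d2 by []; apply/funext => h; rewrite /d1 /d2 /=.
  by rewrite addr0 scale0r add0r [h *: 1]mulr1.
apply: (is_derive_eq D'); case: D => _ ->; ring.
Qed.

Lemma elementary_is_derive f : elementary f -> forall i, exists2 g, elementary g &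
  forall x, is_derive x (delta_mx ord0 i) f (g x).
Proof.
elim=> {f} [c|j|k c b j|f g ef IHf eg IHg|f g ef IHf eg IHg] i.
- by exists (fun=> 0); [exact: elementary_cst|move=> x; exact: is_derive_cst].
- exists (fun=> (j == i)%:R); first exact: elementary_cst.
  move=> x; have H := @is_derive_affine_coord id 1 0 1 j x (delta_mx ord0 i)
    (is_derive_id _ _).
  rewrite (_ : (fun y => _) = (fun y : 'rV[R]_n => id (1 * y ord0 j + 0))); last first.
    by apply/funext => y; rewrite mul1r addr0.
  by apply: (is_derive_eq H); rewrite !mxE eqxx /= mul1r mulr1.
- exists (fun x => c * (j == i)%:R *
    (flat k.+2 (c * x ord0 j + b) + (- k%:R) * flat k.+1 (c * x ord0 j + b))).
    apply: elementary_mul; first exact: elementary_cst.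
    apply: elementary_add; first exact: elementary_flat.
    by apply: elementary_mul; [exact: elementary_cst|exact: elementary_flat].
  move=> x; have H := @is_derive_affine_coord _ c b _ j x (delta_mx ord0 i)
    (is_derive_flat k _).
  by apply: (is_derive_eq H); rewrite !mxE eqxx /= mulNr.
- have [f' ef' Hf] := IHf i; have [g' eg' Hg] := IHg i.
  exists (fun x => f' x + g' x); first exact: elementary_add.
  by move=> x; exact: (is_deriveD (Hf x) (Hg x)).
- have [f' ef' Hf] := IHf i; have [g' eg' Hg] := IHg i.
  exists (fun x => f x * g' x + g x * f' x).
    by apply: elementary_add; exact: elementary_mul.
  by move=> x; exact: (is_deriveM (Hf x) (Hg x)).
Qed.

Lemma elementary_continuous f : elementary f -> continuous f.
Proof.
elim=> {f} [c|j|k c b j|f g ef IHf eg IHg|f g ef IHf eg IHg] x.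
- exact: cst_continuous.
- exact: (@coord_continuous R 1 n ord0 j x).
- apply: (@continuous_comp _ _ _ (fun x : 'rV[R]_n => c * x ord0 j + b) (flat k)).
    apply: continuousD; last exact: cst_continuous.
    by apply: continuousM; [exact: cst_continuous|exact: (@coord_continuous R 1 n ord0 j x)].
  apply/differentiable_continuous/derivable1_diffP.
  by have [] := is_derive_flat k (c * x ord0 j + b).
- exact: (cvgD (IHf x) (IHg x)).
- exact: (cvgM (IHf x) (IHg x)).
Qed.

Lemma elementary_pderiv s f : elementary f -> elementary (pderiv s f).
Proof.
elim: s => //= i s IH /IH /elementary_is_derive /(_ i) [g eg H].
by rewrite (_ : (fun x => _) = g)//; apply/funext => x; have [_ ->] := H x.
Qed.

Lemma elementary_derivable f i x : elementary f -> derivable f x (delta_mx ord0 i).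
Proof. by move=> /elementary_is_derive /(_ i) [g _ H]; have [] := H x. Qed.

Lemma elementary_prod (I : Type) (s : seq I) (F : I -> 'rV[R]_n -> R) :
  (forall i, elementary (F i)) -> elementary (fun x => \prod_(i <- s) F i x).
Proof.
move=> eF; elim: s => [|i s IH].
  rewrite (_ : (fun x => _) = fun=> 1); first exact: elementary_cst.
  by apply/funext => x; rewrite big_nil.
rewrite (_ : (fun x => _) = (fun x => F i x * \prod_(j <- s) F j x)).
  exact: elementary_mul.
by apply/funext => x; rewrite big_cons.
Qed.

Lemma elementary_sum (I : Type) (s : seq I) (F : I -> 'rV[R]_n -> R) :
  (forall i, elementary (F i)) -> elementary (fun x => \sum_(i <- s) F i x).
Proof.
move=> eF; elim: s => [|i s IH].
  rewrite (_ : (fun x => _) = fun=> 0); first exact: elementary_cst.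
  by apply/funext => x; rewrite big_nil.
rewrite (_ : (fun x => _) = (fun x => F i x + \sum_(j <- s) F j x)).
  exact: elementary_add.
by apply/funext => x; rewrite big_cons.
Qed.

Lemma elementary_exp f k : elementary f -> elementary (fun x => f x ^+ k).
Proof.
move=> ef; elim: k => [|k IH]; first exact: elementary_cst.
rewrite (_ : (fun x => _) = (fun x => f x * f x ^+ k)).
  exact: elementary_mul.
by apply/funext => x; rewrite exprS.
Qed.

Lemma elementary_mpoly (p : mpoly.mpoly n R) :
  elementary (fun x => mpoly.meval (fun i => x ord0 i) p).
Proof.
apply: elementary_sum => m; apply: elementary_mul; first exact: elementary_cst.
apply: elementary_prod => i; apply: elementary_exp; exact: elementary_coord.
Qed.

Lemma elementary_test_function Om f : elementary f ->
  compact (closure [set x | f x != 0]) -> closure [set x | f x != 0] `<=` Om ->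
  test_function Om f.
Proof.
move=> ef cf sf; split => // [s|s i x].
- exact/elementary_continuous/elementary_pderiv.
- exact/elementary_derivable/elementary_pderiv.
Qed.

(** Iterated partial derivatives are local. *)
Lemma pderiv_open (U : set 'rV[R]_n) s f g : open U ->
  (forall x, U x -> f x = g x) -> forall x, U x -> pderiv s f x = pderiv s g x.
Proof.
move=> oU fg; elim: s => //= i s IH x Ux.
apply: near_eq_derive; have : nbhs x U by exact: open_nbhs_nbhs.
by apply: filterS => y Uy; exact: IH.
Qed.

End elementary.

(** * Bump functions *)

Section orthants.
Context {R : realType} {n : nat}.

Definition orthant (a : 'rV[R]_n) : set 'rV[R]_n :=
  [set x | forall i, a ord0 i < x ord0 i].

Definition orthants : set (set 'rV[R]_n) := range orthant.

Lemma orthants_setI : setI_closed orthants.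
Proof.
move=> _ _ [a _ <-] [b _ <-].
exists (\row_i Num.max (a ord0 i) (b ord0 i)) => //.
apply/seteqP; split => [x /= h|x /= [h1 h2] i]; last by rewrite mxE gt_max h1 h2.
by split => i; have := h i; rewrite mxE gt_max => /andP[].
Qed.

(** A coordinate half-space is the increasing union of the orthants whose other
    bounds tend to minus infinity. *)
Lemma measurable_orthants : @measurable _ 'rV[R]_n = <<s orthants >>.
Proof.
apply/seteqP; split.
  apply: smallest_sub; first exact: smallest_sigma_algebra.
  rewrite -bigcup_seq => A /= [i _ [B mB <-]].
  have : measurable_fun setT ((fun x : g_sigma_algebraType orthants =>
      (x : 'rV[R]_n) ord0 i) : _ -> measurableTypeR R).
    apply: (measurability _ (RGenOInfty.measurableE R)) => //.
    move=> C /= [_ [a ->] <-]; rewrite setTI.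
    have -> : (fun x : g_sigma_algebraType orthants => (x : 'rV[R]_n) ord0 i)
        @^-1` `]a, +oo[%classic =
        \bigcup_k orthant (\row_j (if j == i then a else - k%:R)).
      apply/seteqP; split => x /=; rewrite in_itv /= andbT.
        move=> ax; pose M := \sum_j `|(x : 'rV[R]_n) ord0 j|.
        (* M dominates the absolute value of every coordinate of x *)
        exists (Num.truncn M).+1 => // j; rewrite mxE; case: eqVneq => [->//|_].
        rewrite ltrNl; apply: (le_lt_trans (ler_norm _)); rewrite normrN.
        apply: le_lt_trans (truncnS_gt M).
        by rewrite /M (bigD1 j)//= lerDl sumr_ge0.
      by move=> [k _ /(_ i)]; rewrite mxE eqxx.
    apply: bigcupT_measurable => k; apply: sub_sigma_algebra.
    by exists (\row_j (if j == i then a else - k%:R)).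
  by move=> /(_ measurableT B mB); rewrite setTI.
apply: smallest_sub; first exact: sigma_algebra_measurable.
move=> _ [a _ <-].
have -> : orthant a = \bigcap_(i in [set: 'I_n]) ((fun x : 'rV[R]_n => x ord0 i :
    measurableTypeR R) @^-1` `]a ord0 i, +oo[%classic).
  apply/seteqP; split => x /= h i; first by move=> _; rewrite /= in_itv /= andbT.
  by have := h i I; rewrite /= in_itv /= andbT.
apply: fin_bigcap_measurable => // i _; rewrite -[X in measurable X]setTI.
by apply: measurable_coord => //; exact: measurable_itv.
Qed.

(** Smooth functions with values in [0, 1] that converge to the indicator of
    the orthant: flat 0 (k t) tends to 1 for t > 0 and is 0 otherwise. *)
Definition orthant_bump (a : 'rV[R]_n) (k : nat) (x : 'rV[R]_n) : R :=
  \prod_(i < n) flat 0 (k.+1%:R * x ord0 i + - (k.+1%:R * a ord0 i)).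

Lemma elementary_orthant_bump a k : elementary (orthant_bump a k).
Proof. by apply: elementary_prod => i; exact: elementary_flat. Qed.

Lemma orthant_bump01 a k x : 0 <= orthant_bump a k x <= 1.
Proof.
rewrite prodr_ge0 => [|i _]; last exact: flat_ge0.
by apply: prodr_ile1 => i _; rewrite flat_ge0 flat0_le1.
Qed.

Lemma cvg_orthant_bump a x : orthant_bump a k x @[k --> \oo] --> (\1_(orthant a) x : R).
Proof.
have [ax|nax] := pselect (orthant a x); last first.
  rewrite indicE memNset//; apply: cvg_near_cst; apply: nearW => k.
  have [i /negP] : exists i, ~ (a ord0 i < x ord0 i) by apply/existsNP.
  rewrite -leNgt => xa; rewrite /orthant_bump (bigD1 i)//= [X in X * _](_ : _ = 0) ?mul0r//.
  rewrite /flat -mulrBr pmulr_rgt0 ?ltr0n// subr_gt0 ltNge xa //.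
rewrite indicE mem_set//.
have -> : true%:R = \prod_(i < n) (1 : R) by rewrite big1.
apply: (@cvg_big R _ *%R 1 xpredT mul_continuous) => i _.
have t0 : 0 < x ord0 i - a ord0 i by rewrite subr_gt0.
rewrite (_ : (fun k => _) = (fun k => expR (- (harmonic k * (x ord0 i - a ord0 i)^-1)))).
  rewrite -[X in _ --> X](@expR0 R); apply: continuous_cvg; first exact: continuous_expR.
  rewrite -[X in _ --> X]oppr0; apply: cvgN.
  rewrite -[X in _ --> X](mul0r (x ord0 i - a ord0 i)^-1).
  by apply: cvgM; [exact: cvg_harmonic|exact: cvg_cst].
apply/funext => k; rewrite /flat -mulrBr pmulr_rgt0 ?ltr0n// t0 expr0 mul1r.
by rewrite invfM.
Qed.

End orthants.

Section box_bump.
Context {R : realType} {n : nat}.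
Implicit Types (q x : 'rV[R]_n) (e : R).

Definition box_bump q e x : R :=
  \prod_(i < n) (flat 0 (1 * x ord0 i + (e - q ord0 i)) *
                 flat 0 (- 1 * x ord0 i + (q ord0 i + e))).

Lemma elementary_box_bump q e : elementary (box_bump q e).
Proof. by apply: elementary_prod => i; apply: elementary_mul; exact: elementary_flat. Qed.

Lemma box_bump_ge0 q e x : 0 <= box_bump q e x.
Proof. by apply: prodr_ge0 => i _; rewrite mulr_ge0// flat_ge0. Qed.

Lemma box_bump_le1 q e x : box_bump q e x <= 1.
Proof. by apply: prodr_ile1 => i _; rewrite mulr_ge0 ?mulr_ile1 ?flat_ge0 ?flat0_le1. Qed.

Lemma box_bump_neq0 q e x : (box_bump q e x != 0) <-> ocube q e x.
Proof.
have E i : (flat 0 (1 * x ord0 i + (e - q ord0 i)) *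
    flat 0 (- 1 * x ord0 i + (q ord0 i + e)) != 0) = (`|x ord0 i - q ord0 i| < e).
  rewrite mulf_eq0 negb_or !flat0_neq0 ltr_norml.
  by congr (_ && _); apply/idP/idP; lra.
split=> [|h].
  by move=> /prodf_neq0 h i; rewrite -E; exact: h.
by apply/prodf_neq0 => i _; rewrite E; exact: h.
Qed.

Lemma ccube_closed q e : closed (ccube q e).
Proof.
have -> : ccube q e = \bigcap_(i in [set: 'I_n])
    ((fun x : 'rV[R]_n => `|x ord0 i - q ord0 i|) @^-1` [set y | y <= e]).
  by apply/seteqP; split => x h i; [move=> _|]; exact: (h i).
apply: closed_bigI => i _; apply: closed_comp => [x _|]; last exact: closed_le.
exact: (cvg_norm (cvgB (@coord_continuous R 1 n ord0 i x) (cvg_cst (q ord0 i)))).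
Qed.

Lemma ccube_bounded q e : bounded_set (ccube q e).
Proof.
exists (`|e| + `|q|); split; first exact: num_real.
move=> M hM x xe; apply: le_trans (ltW hM).
rewrite [leLHS]/Num.norm /= mx_normrE; apply: bigmax_le => [|[i j] _] /=.
  by rewrite addr_ge0.
rewrite (ord1 i) -(subrK (q ord0 j) (x ord0 j)) (le_trans (ler_normD _ _))//.
apply: lerD; first by rewrite (le_trans (xe j))// ler_norm.
rewrite [leRHS]/Num.norm /= mx_normrE.
by apply/bigmax_geP; right => /=; exists (ord0, j).
Qed.

Lemma box_bump_test_function Om q e h : ccube q e `<=` Om -> elementary h ->
  test_function Om (fun x => box_bump q e x * h x).
Proof.
move=> qOm eh.
have sub : closure [set x | box_bump q e x * h x != 0] `<=` ccube q e.
  rewrite closureE; apply: smallest_sub; first exact: ccube_closed.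
  move=> x /=; rewrite mulf_eq0 negb_or => /andP[/box_bump_neq0 xq _] i.
  exact: ltW.
apply: elementary_test_function.
- by apply: elementary_mul => //; exact: elementary_box_bump.
- apply: (subclosed_compact _ _ sub); first exact: closed_closure.
  by apply: bounded_closed_compact; [exact: ccube_bounded|exact: ccube_closed].
- exact: subset_trans sub qOm.
Qed.

End box_bump.

(** * The fundamental lemma of the calculus of variations *)

Section fundamental_lemma.
Context {R : realType} {n : nat}.
Local Notation mu := (lebesgue_rV n : {measure set 'rV[R]_n -> \bar R}).

(** Dominated convergence turns the vanishing moments into vanishing integrals
    over all orthants; these form a pi-system, so the integral of G over every
    measurable subset of D vanishes. *)
Lemma orthant_moments_ae0 (D : set 'rV[R]_n) (G : 'rV[R]_n -> R) :
  measurable D -> measurable_fun setT G -> mu.-integrable D (EFin \o G) ->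
  \int[mu]_(x in D) G x = 0 ->
  (forall a k, \int[mu]_(x in D) (G x * orthant_bump a k x) = 0) ->
  ae_eq mu D G (cst 0).
Proof.
move=> mD mG iG G0 Gk.
have mS (A : set 'rV[R]_n) : measurable A -> mu.-integrable (D `&` A) (EFin \o G).
  by move=> mA; apply: integrableS iG => //; exact: measurableI.
have GA (A : set 'rV[R]_n) : measurable A -> \int[mu]_(x in D `&` A) G x = 0.
  move=> mA; pose P (A : set 'rV[R]_n) := \int[mu]_(x in D `&` A) G x = 0.
  rewrite -/(P A).
  apply: (dynkin_induction measurable_orthants orthants_setI).
  - by rewrite /P setIT.
  (* on an orthant: G times its bumps converges to the restriction of G *)
  - move=> _ [a _ <-]; rewrite /P.
    have mo : measurable (orthant a).
      by rewrite measurable_orthants; apply: sub_sigma_algebra; exists a.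
    rewrite Rintegral_mkcondr.
    pose f_ k := EFin \o (fun x => G x * orthant_bump a k x).
    pose f := EFin \o (fun x => G x * \1_(orthant a) x).
    have mb k : measurable_fun setT (orthant_bump a k).
      apply: continuous_measurable_rV; apply: elementary_continuous.
      exact: elementary_orthant_bump.
    have mf_ k : measurable_fun D (f_ k).
      apply/measurable_EFinP; apply: measurable_funM; exact: measurable_funTS.
    have mf : measurable_fun D f.
      apply/measurable_EFinP; apply: measurable_funM; first exact: measurable_funTS.
      exact: measurable_indic.
    have dom k x : (`|f_ k x| <= (`|G x|)%:E)%E.
      rewrite lee_fin normrM ler_piMr//.
      by have /andP[b0 b1] := orthant_bump01 a k x; rewrite ger0_norm.
    have f_f : {ae mu, forall x, D x -> f_ ^~ x @ \oo --> f x}.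
      apply: aeW => x _; apply/fine_cvgP; split; first exact: nearW.
      by apply: (@cvgM R nat \oo _ (cst (G x)) (fun k => orthant_bump a k x));
        [exact: cvg_cst|exact: cvg_orthant_bump].
    have f_g : {ae mu, forall x k, D x -> (`|f_ k x| <= (EFin \o (Num.norm \o G)) x)%E}.
      by apply: aeW => x k _; exact: dom.
    have [_ _ C] := dominated_convergence mD mf_ mf f_f (integrable_norm iG) f_g.
    have Z k : (\int[mu]_(x in D) f_ k x = 0)%E.
      have ifk : mu.-integrable D (f_ k).
        apply: le_integrable iG => // x _; exact: dom.
      rewrite -[LHS]fineK; last exact: integrable_fin_num.
      by congr EFin; exact: Gk.
    have C0 : (\int[mu]_(x in D) f x = 0)%E.
      rewrite -(cvg_lim _ C)//; apply/cvg_lim => //.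
      by apply: cvg_near_cst; apply: nearW => k; exact: Z.
    have -> : (\int[mu]_(x in D) (G \_ (orthant a)) x = \int[mu]_(x in D) (G x * \1_(orthant a) x)).
      by apply: eq_Rintegral => x _; rewrite patchE indicE; case: ifP => _; rewrite ?mulr1 ?mulr0.
    by rewrite /Rintegral C0.
  - move=> S mS' PS; rewrite /P.
    have DE : D = (D `&` S) `|` (D `&` ~` S) by rewrite -setIUr setUv setIT.
    have : \int[mu]_(x in D) G x = \int[mu]_(x in D `&` S) G x + \int[mu]_(x in D `&` ~` S) G x.
      rewrite {1}DE Rintegral_setU//; [exact: measurableI|
        by apply: measurableI => //; exact: measurableC|by rewrite -DE|].
      by apply/disj_setPS => x [[_ Sx] [_]].
    by rewrite G0 PS add0r => <-.
  - move=> F mF tF PF; rewrite /P setI_bigcupr /Rintegral integral_bigcup//.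
    + rewrite eseries0// => i _ _.
      rewrite -[LHS]fineK; last first.
        by apply: integrable_fin_num; [exact: measurableI|exact: mS].
      by congr EFin; exact: PF.
    + exact: trivIset_setIl.
    + by move=> k; exact: measurableI.
    + by rewrite -setI_bigcupr; apply: mS; exact: bigcupT_measurable.
  - by rewrite -measurable_orthants.
suff : ae_eq mu D (EFin \o G) (cst 0%E).
  by apply: filterS => x /[apply] /= -[->].
apply: integral_ae_eq => // E ED mE.
rewrite integral_cst// mul0e -[LHS]fineK; last first.
  apply: integrable_fin_num => //; exact: integrableS iG.
by congr EFin; rewrite -[E](setIidr ED); exact: GA.
Qed.

(** A test function supported in a cube inside Om remains one after
    multiplication by an orthant bump, although the latter has no compact
    support. *)
Lemma box_bump_ae0 (Om : set 'rV[R]_n) g q e : open Om -> bounded_set Om ->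
  L2 Om g -> (forall phi, test_function Om phi -> \int[mu]_(x in Om) (g x * phi x) = 0) ->
  ccube q e `<=` Om -> ae_eq mu Om (fun x => g x * box_bump q e x) (cst 0).
Proof.
move=> oO bO [mg ig] g0 qO.
have mO : measurable Om by exact: open_measurable_rV.
have mb : measurable_fun setT (box_bump q e).
  by apply: continuous_measurable_rV; apply: elementary_continuous; exact: elementary_box_bump.
have i1 : mu.-integrable Om (fun x => ((box_bump q e x) ^+ 2)%:E).
  apply: (@measurable_bounded_integrable _ _ _ mu (fun x => (box_bump q e x) ^+ 2)) => //.
  - exact: bounded_lebesgue_fin.
  - by apply: measurable_funTS; exact: measurable_funX.
  - exists 1; split => // M M1 x _ /=; rewrite ger0_norm ?sqr_ge0//.
    by rewrite (le_trans _ (ltW M1))// exprn_ile1 ?box_bump_ge0 ?box_bump_le1.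
apply: orthant_moments_ae0 => //.
- exact: measurable_funM.
- by apply: integrable_mul => //; exact: measurable_funTS.
- apply: g0; rewrite (_ : box_bump q e = (fun x => box_bump q e x * 1)).
    by apply: box_bump_test_function => //; exact: elementary_cst.
  by apply/funext => x; rewrite mulr1.
- move=> a k; rewrite -[RHS](g0 (fun x => box_bump q e x * orthant_bump a k x)).
    by apply: eq_Rintegral => x _; rewrite mulrA.
  by apply: box_bump_test_function => //; exact: elementary_orthant_bump.
Qed.

(** The cubes inside Om on which the previous lemma makes g vanish almost
    everywhere are countably many and cover Om. *)
Lemma fundamental_lemma (Om : set 'rV[R]_n) g : open Om -> bounded_set Om ->
  L2 Om g -> (forall phi, test_function Om phi -> \int[mu]_(x in Om) (g x * phi x) = 0) ->
  ae_eq mu Om g (cst 0).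
Proof.
move=> oO bO Lg g0.
pose N (p : 'rV[rat]_n * rat) : set 'rV[R]_n :=
  ~` [set x | Om x -> g x * box_bump (rat_cube p).1 (rat_cube p).2 x = 0].
pose F k : set 'rV[R]_n := if unpickle k is Some p then
  if `[< ccube (@rat_cube R n p).1 (rat_cube p).2 `<=` Om >] then N p else set0
  else set0.
have F0 k : mu.-negligible (F k).
  rewrite /F; case: (unpickle k) => [p|]; last exact: negligible_set0.
  case: asboolP => [pO|_]; last exact: negligible_set0.
  exact: box_bump_ae0.
apply: negligibleS (negligible_bigcup F0) => x /= /not_implyP[Ox /eqP gx].
have [p [xp pO]] := open_rat_cube oO Ox.
exists (pickle p) => //; rewrite /F pickleK; case: asboolP => // _.
apply/not_implyP; split => //; apply/eqP; rewrite mulf_neq0//.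
exact/box_bump_neq0.
Qed.

Lemma pderiv_cst0 s : pderiv s (cst 0 : 'rV[R]_n -> R) = cst 0.
Proof.
elim: s => //= i s ->; apply/funext => x.
by rewrite (@derive_val _ _ _ _ _ _ _ (is_derive_cst (0 : R) x (delta_mx ord0 i))).
Qed.

Lemma test_function0 (Om : set 'rV[R]_n) : test_function Om (cst 0).
Proof.
apply: elementary_test_function; first exact: elementary_cst.
  rewrite (_ : [set x | _] = set0) ?closure0; first exact: compact0.
  by apply/seteqP; split => x //=; rewrite eqxx.
rewrite (_ : [set x | _] = set0) ?closure0//.
by apply/seteqP; split => x //=; rewrite eqxx.
Qed.

Lemma L2_cst0 (Om : set 'rV[R]_n) : measurable Om -> L2 Om (cst 0).
Proof.
move=> mO; split; first exact: measurable_cst.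
rewrite (_ : (fun x => _) = cst 0%E); first exact: integrable0.
by apply/funext => x /=; rewrite expr0n.
Qed.

(** The definition of Hm0 quantifies over every weak derivative g of the
    function, so membership of 0 rests on the uniqueness of weak derivatives. *)
Lemma Hm0_cst0 m (Om : set 'rV[R]_n) : open Om -> bounded_set Om -> Hm0 m Om (cst 0).
Proof.
move=> oO bO; have mO : measurable Om by exact: open_measurable_rV.
have R0 phi : \int[mu]_(x in Om) (cst 0 x * phi x) = 0.
  by under eq_Rintegral do rewrite mul0r; rewrite Rintegral_cst// mul0r.
split.
  split; first exact: L2_cst0.
  move=> s _; exists (cst 0); split; first exact: L2_cst0.
  by move=> phi _; rewrite !R0 mulr0.
exists (fun=> cst 0); split => [j|s g _ [mg ig] wg]; first exact: test_function0.
apply: cvg_near_cst; apply: nearW => j; rewrite pderiv_cst0.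
have g0 : ae_eq mu Om g (cst 0).
  apply: fundamental_lemma => // phi /wg; rewrite R0 => /esym/eqP.
  by rewrite mulf_eq0 signr_eq0 => /eqP.
rewrite /L2norm (ae_eq0_Rintegral (mu := mu)) ?sqrtr0//.
- by apply: measurable_funTS; apply: measurable_funX; exact: measurable_funB.
- by apply: filterS g0 => x /[apply] /= ->; rewrite subr0 expr0n.
Qed.

End fundamental_lemma.

(** * Triangulations and piecewise smooth functions *)

Definition interiors {R : realType} {n : nat} (TT : set (set 'rV[R]_n)) :=
  \bigcup_(T in TT) interior T.

(** Piecewise polynomials only enter through this larger class: it is stable
    under partial derivatives and subtraction, and nothing but smoothness up to
    the boundary of each simplex matters for the integrals below. *)
Definition pw_elementary {R : realType} {n : nat} (TT : set (set 'rV[R]_n))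
    (v : 'rV[R]_n -> R) :=
  measurable_fun setT v /\ forall T, TT T -> exists2 p, elementary p &
    forall x, interior T x -> v x = p x.

Section triangulation.
Context {R : realType} {n : nat} (n_gt0 : (0 < n)%N) (Om : set 'rV[R]_n)
  (HOm : polyhedral_lipschitz_domain Om).
Local Notation mu := (lebesgue_rV n : {measure set 'rV[R]_n -> \bar R}).

Let oOm : open Om. Proof. by case: HOm => -[]. Qed.
Let bOm : bounded_set Om. Proof. by case: HOm => -[]. Qed.

Lemma domain_measurable : measurable Om.
Proof. exact: open_measurable_rV. Qed.

Lemma domain_lebesgue_fin : (mu Om < +oo)%E.
Proof. by apply: bounded_lebesgue_fin => //; exact: domain_measurable. Qed.

(** A polyhedral boundary lies in finitely many hyperplanes. *)
Lemma domain_boundary_negligible : mu.-negligible (closure Om `\` Om).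
Proof.
have [_ [_ [F [finF flat_F bF]]]] := HOm.
have sub : closure Om `\` Om `<=` \bigcup_(P in F) P.
  by rewrite -bF => x [cx nx]; split => // /interior_subset.
apply: negligibleS sub _; apply: negligible_fin_bigcup => // P /flat_F.
move=> [_ [nu [c [nu0 Pnu]]]].
apply: (@negligibleS _ _ _ _ [set x | dotv x nu = c]) => //.
by apply/negligibleP; [exact: hyperplane_measurable|exact: hyperplane_null].
Qed.

Lemma domain_closure_bounded : bounded_set (closure Om).
Proof.
have [M M0 OM] := bounded_ccube bOm; have [N [Nr NP]] := @ccube_bounded R n 0 M.
exists N; split => // e /NP eP x cx; apply: eP; move: x cx.
rewrite closureE; apply: smallest_sub => //; exact: ccube_closed.
Qed.

Lemma domain_closure_compact : compact (closure Om).
Proof.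
by apply: bounded_closed_compact; [exact: domain_closure_bounded|exact: closed_closure].
Qed.

Section one_triangulation.
Context {TT : set (set 'rV[R]_n)} (HTT : regular_triangulation Om TT).

Lemma triangulation_finite : finite_set TT. Proof. by case: HTT. Qed.

Lemma triangulation_measurable T : TT T -> measurable T.
Proof. by move=> TTT; apply: simplex_measurable => //; case: HTT => _ + _ _ _; exact. Qed.

Lemma triangulation_sub T : TT T -> T `<=` closure Om.
Proof. by case: HTT => _ _ -> _ _ TTT; exact: bigcup_sup. Qed.

Lemma triangulation_skeleton_negligible T : TT T -> mu.-negligible (T `\` interior T).
Proof.
by move=> TTT; apply: simplex_boundary_negligible => //; case: HTT => _ + _ _ _; exact.
Qed.

Lemma trivIset_interior : trivIset TT interior.
Proof.
apply/trivIsetP => T1 T2 T1T T2T /eqP T12; case: HTT => _ _ _ + _; exact.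
Qed.

Lemma open_interiors : open (interiors TT).
Proof. by apply: bigcup_open => T _; exact: open_interior. Qed.

Lemma interiors_measurable : measurable (interiors TT).
Proof. exact: open_measurable_rV open_interiors. Qed.

Lemma interiors_sub : interiors TT `<=` closure Om.
Proof. by move=> x [T TTT /interior_subset]; exact: triangulation_sub. Qed.

Lemma domain_interiors_negligible : mu.-negligible (Om `\` interiors TT).
Proof.
apply: negligibleS (negligible_fin_bigcup triangulation_finite triangulation_skeleton_negligible).
move=> x [Ox nx]; have : closure Om x by exact: subset_closure.
case: HTT => _ _ -> _ _ [T TTT Tx]; exists T => //; split => // iTx.
by apply: nx; exists T.
Qed.

Lemma interiors_domain_negligible : mu.-negligible (interiors TT `\` Om).
Proof.
apply: negligibleS domain_boundary_negligible => x [/interiors_sub] cx nx; by split.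
Qed.

Lemma integrable_simplex F T : TT T -> measurable_fun setT F ->
  mu.-integrable Om (EFin \o F) -> mu.-integrable T (EFin \o F).
Proof.
move=> TTT mF iF.
have mT := triangulation_measurable TTT.
have mO := domain_measurable.
apply: (@integrable_negl _ _ _ mu (T `&` Om)) => //.
- exact: measurableI.
- by apply: negligibleS (@negligible_set0 _ _ _ mu) => x [[]].
- apply: negligibleS domain_boundary_negligible => x [Tx nTO]; split.
    exact: triangulation_sub Tx.
  by move=> Ox; apply: nTO.
- exact/measurable_EFinP.
- by apply: integrableS iF => //; exact: measurableI.
Qed.

Lemma Rintegral_triangulation F : measurable_fun setT F ->
  mu.-integrable Om (EFin \o F) ->
  \int[mu]_(x in Om) F x = \sum_(T \in TT) \int[mu]_(x in T) F x.
Proof.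
move=> mF iF.
have mO := domain_measurable.
rewrite (Rintegral_negl mO interiors_measurable domain_interiors_negligible
  interiors_domain_negligible mF).
rewrite Rintegral_fin_bigcup.
- apply: eq_fsbigr => T /[!inE] TTT; apply: Rintegral_negl => //.
  + exact: interior_measurable_rV.
  + exact: triangulation_measurable.
  + by apply: negligibleS (@negligible_set0 _ _ _ mu) => x [/interior_subset].
  + exact: triangulation_skeleton_negligible.
- exact: triangulation_finite.
- by move=> T; exact: interior_measurable_rV.
- exact: trivIset_interior.
- apply: (integrable_negl mO interiors_measurable domain_interiors_negligible
    interiors_domain_negligible) => //.
  exact/measurable_EFinP.
Qed.

Lemma pw_poly_elementary k : pw_poly k TT `<=` pw_elementary TT.
Proof.
move=> v [mv vp]; split => // T /vp[p [_ vpE]].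
exists (fun x => mpoly.meval (fun i => x ord0 i) p); first exact: elementary_mpoly.
by move=> x; exact: vpE.
Qed.

Lemma pw_elementary_lin c v w : pw_elementary TT v -> pw_elementary TT w ->
  pw_elementary TT (fun x => c * v x + w x).
Proof.
move=> [mv vp] [mw wp]; split.
  by apply: measurable_funD => //; apply: measurable_funM.
move=> T TTT; have [p ep vE] := vp _ TTT; have [q eq wE] := wp _ TTT.
exists (fun x => c * p x + q x); last by move=> x xT; rewrite vE ?wE.
apply: elementary_add => //; apply: elementary_mul => //; exact: elementary_cst.
Qed.

Lemma pw_pderivE s v T : TT T -> forall p,
  (forall x, interior T x -> v x = p x) ->
  forall x, interior T x -> pw_pderiv TT s v x = pderiv s p x.
Proof.
move=> TTT p vp x xT; rewrite /pw_pderiv patchE mem_set; last by exists T.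
exact: (pderiv_open s (@open_interior _ T) vp).
Qed.

Lemma pw_pderiv_measurable s v : pw_elementary TT v ->
  measurable_fun setT (pw_pderiv TT s v).
Proof.
move=> [_ vp]; apply/(measurable_restrictT _ interiors_measurable).
apply: measurable_fun_fin_bigcup; first exact: triangulation_finite.
  by move=> T _; exact: interior_measurable_rV.
move=> T TTT; have [p ep vE] := vp _ TTT.
apply: (@eq_measurable_fun _ _ _ _ _ (pderiv s p)).
  by move=> x /[!inE] xT; rewrite (pderiv_open s (@open_interior _ T) vE).
apply: measurable_funTS; apply: continuous_measurable_rV.
by apply: elementary_continuous; exact: elementary_pderiv.
Qed.

(** On each simplex the derivative extends to a continuous function on the
    compact closure of Om. *)
Lemma pw_pderiv_bounded s v : pw_elementary TT v ->
  exists2 M, 0 <= M & forall x, `|pw_pderiv TT s v x| <= M.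
Proof.
move=> [_ vp].
have bd T : exists M : R, TT T -> forall x, interior T x -> `|pw_pderiv TT s v x| <= M.
  have [TTT|] := pselect (TT T); last by exists 0.
  have [p ep vE] := vp _ TTT.
  have : compact (pderiv s p @` closure Om).
    apply: continuous_compact; last exact: domain_closure_compact.
    apply: continuous_subspaceT; apply: elementary_continuous.
    exact: elementary_pderiv.
  move=> /compact_bounded [M [_ MP]]; exists (M + 1) => _ x iTx.
  rewrite (pw_pderivE s TTT vE)//.
  apply: (MP (M + 1)); first by rewrite ltrDl.
  by exists x => //; apply: triangulation_sub TTT _ _; exact: interior_subset.
have [M MP] := choice bd.
exists (\sum_(T \in TT) `|M T|); first by apply: fsumr_ge0.
move=> x; rewrite {1}/pw_pderiv patchE; case: ifPn => [|_]; last first.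
  by rewrite normr0; apply: fsumr_ge0.
rewrite inE => -[T TTT iTx].
have := MP T TTT x iTx; rewrite {1}/pw_pderiv patchE mem_set; last by exists T.
move=> /le_trans; apply; rewrite (fsbigD1 T)//=.
  by rewrite (le_trans (ler_norm _))// lerDl; apply: fsumr_ge0.
exact: triangulation_finite.
Qed.

End one_triangulation.
End triangulation.

(** * Refinements and the energy norm *)

Section two_triangulations.
Context {R : realType} {n : nat} (n_gt0 : (0 < n)%N) (Om : set 'rV[R]_n)
  (HOm : polyhedral_lipschitz_domain Om) {TT TTh : set (set 'rV[R]_n)}
  (HTT : regular_triangulation Om TT) (HTTh : regular_triangulation Om TTh).
Local Notation mu := (lebesgue_rV n : {measure set 'rV[R]_n -> \bar R}).

(** The refinement hypothesis describes a coarse simplex by fine ones. For the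
    converse inclusion, a fine simplex K contained in no coarse one would have
    its interior covered by other fine simplices, hence, interiors being
    disjoint, by their null boundaries. *)
Lemma refines_sub K : refines TTh TT -> TTh K -> interior K !=set0 ->
  exists2 T, TT T & K `<=` T.
Proof.
move=> ref TK [x iKx]; apply: contrapT => nT.
have sub : interior K `<=` \bigcup_(K' in TTh) (K' `\` interior K').
  move=> y iKy; have : closure Om y.
    exact: (triangulation_sub HTTh TK (interior_subset iKy)).
  have [_ _ -> _ _] := HTT; move=> [T TTT]; rewrite (ref T TTT).
  move=> [K' [TK' K'T] K'y]; exists K' => //; split => // iK'y.
  have [KK'|KK'] := pselect (K = K').
    by apply: nT; exists T => //; rewrite KK'.
  have [_ _ _ + _] := HTTh => /(_ K K' TK TK' KK') => E.
  by have : (interior K `&` interior K') y by []; rewrite E.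
have null : mu.-negligible (interior K).
  apply: negligibleS sub _; apply: negligible_fin_bigcup.
    exact: (triangulation_finite HTTh).
  exact: (triangulation_skeleton_negligible n_gt0 HTTh).
have : interior K = set0.
  apply: open_lebesgue0; first exact: open_interior.
  by apply/negligibleP => //; exact: interior_measurable_rV.
by move=> E; rewrite E in iKx.
Qed.

(** Transfers coarse functions to the fine triangulation, with respect to which
    the derivatives in a_h are taken. *)
Lemma pw_elementary_refines v : refines TTh TT ->
  pw_elementary TT v -> pw_elementary TTh v.
Proof.
move=> ref [mv vp]; split => // K TK.
have [/(refines_sub ref TK)[T TTT KT]|nK] := pselect (interior K !=set0).
  have [p ep vE] := vp T TTT; exists p => // x iKx; apply: vE.
  exact: (interiorS KT).
exists (fun=> 0); first exact: elementary_cst.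
by move=> x iKx; exfalso; apply: nK; exists x.
Qed.

Lemma pw_elementary_L2 v : pw_elementary TT v -> L2 Om v.
Proof.
move=> pv; have [mv _] := pv; split => //.
have mO := domain_measurable HOm.
pose w := pw_pderiv TT [::] v.
have mw : measurable_fun setT w by exact: (pw_pderiv_measurable HTT).
have [M M0 wM] := pw_pderiv_bounded HOm HTT [::] pv.
have mI := @interiors_measurable R n TT.
have iw : mu.-integrable Om (EFin \o (fun x => w x ^+ 2)).
  apply: measurable_bounded_integrable => //.
  - exact: domain_lebesgue_fin.
  - by apply: measurable_funTS; exact: measurable_funX.
  - exists (M ^+ 2); split => [|N MN x _ /=]; first exact: num_real.
    rewrite normrX (le_trans _ (ltW MN))// lerXn2r ?nnegrE//; exact: wM.
have mv2 : measurable_fun setT (EFin \o (fun x => v x ^+ 2)).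
  by apply/measurable_EFinP; exact: measurable_funX.
apply: (integrable_negl mI mO (interiors_domain_negligible HOm HTT)
  (domain_interiors_negligible n_gt0 HTT)) => //.
have mw2 : measurable_fun setT (EFin \o (fun x => w x ^+ 2)).
  by apply/measurable_EFinP; exact: measurable_funX.
have iwI := integrable_negl mO mI (domain_interiors_negligible n_gt0 HTT)
  (interiors_domain_negligible HOm HTT) mw2 iw.
apply: eq_integrable iwI => // x xI /=.
by rewrite /w /pw_pderiv patchE xI.
Qed.

Lemma DNCdot_measurable m v w : pw_elementary TTh v ->
  pw_elementary TTh w -> measurable_fun setT (DNCdot m TTh v w).
Proof.
move=> pv pw; apply: measurable_sum => s.
by apply: measurable_funM; exact: (pw_pderiv_measurable HTTh).
Qed.

Lemma DNCdot_integrable m v w : pw_elementary TTh v ->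
  pw_elementary TTh w -> mu.-integrable Om (EFin \o DNCdot m TTh v w).
Proof.
move=> pv pw; apply: measurable_bounded_integrable.
- exact: domain_measurable.
- exact: domain_lebesgue_fin.
- by apply: measurable_funTS; exact: DNCdot_measurable.
have [M MP] := choice (fun s : m.-tuple 'I_n =>
  let: ex_intro2 M _ h := pw_pderiv_bounded HOm HTTh s pv in ex_intro _ M h).
have [N NP] := choice (fun s : m.-tuple 'I_n =>
  let: ex_intro2 M _ h := pw_pderiv_bounded HOm HTTh s pw in ex_intro _ M h).
exists (\sum_s M s * N s); split => [|B MB x _ /=]; first exact: num_real.
apply: le_trans (ltW MB); rewrite (le_trans (ler_norm_sum _ _ _))//.
apply: ler_sum => s _; rewrite normrM; exact: ler_pM.
Qed.

Lemma DNCdot_ge0 m v x : 0 <= DNCdot m TTh v v x.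
Proof. by apply: sumr_ge0 => s _; rewrite -expr2 sqr_ge0. Qed.

Lemma DNCnorm_sqr m T v : DNCnorm m TTh T v ^+ 2 = \int[mu]_(x in T) DNCdot m TTh v v x.
Proof. by rewrite sqr_sqrtr// Rintegral_ge0// => x _; exact: DNCdot_ge0. Qed.

Lemma norm_hE m v : pw_elementary TTh v ->
  norm_h m TT TTh v = Num.sqrt (a_h m TTh Om v v).
Proof.
move=> pv; rewrite /norm_h; congr Num.sqrt.
rewrite /a_h (Rintegral_triangulation n_gt0 HOm HTT).
- by apply: eq_fsbigr => T _; exact: DNCnorm_sqr.
- exact: DNCdot_measurable.
- exact: DNCdot_integrable.
Qed.

End two_triangulations.

(** * The abstract error estimate *)

Lemma sum_space_linearP {R : realType} {n : nat} (V W : set ('rV[R]_n -> R)) :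
  is_subspace V -> is_subspace W ->
  [/\ V `<=` sum_space V W, W `<=` sum_space V W &
  forall u v, sum_space V W u -> sum_space V W v -> sum_space V W (u \- v)].
Proof.
move=> [V0 Vl] [W0 Wl]; split => [v Vv|w Ww|_ _ [v [w [Vv Ww ->]]] [v' [w' [Vv' Ww' ->]]]].
- by exists v, (cst 0); split => //; apply/funext => x /=; rewrite addr0.
- by exists (cst 0), w; split => //; apply/funext => x /=; rewrite add0r.
- exists (fun x => -1 * v' x + v x), (fun x => -1 * w' x + w x); split; [exact: Vl|exact: Wl|].
  by apply/funext => x /=; ring.
Qed.

Section scalar_product.
Context {R : realType} {n : nat} (Om : set 'rV[R]_n) (V : set ('rV[R]_n -> R))
  (a : ('rV[R]_n -> R) -> ('rV[R]_n -> R) -> R) (Ha : is_scalar_product Om V a).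

Lemma scalar_productBl u v w : V u -> V v -> V w -> a (u \- v) w = a u w - a v w.
Proof.
move=> Vu Vv Vw; have [_ + _ _] := Ha => /(_ (-1) v u w Vv Vu Vw).
rewrite (_ : (fun x => _) = u \- v) => [->|]; first by rewrite mulN1r addrC.
by apply/funext => x /=; ring.
Qed.

Context (VB : forall u v, V u -> V v -> V (u \- v)).

Lemma scalar_productBr u v w : V u -> V v -> V w -> a w (u \- v) = a w u - a w v.
Proof.
move=> Vu Vv Vw; have [sym _ _ _] := Ha.
by rewrite sym ?scalar_productBl ?(sym _ w)//; exact: VB.
Qed.

Lemma scalar_product_polarization x d : V x -> V d ->
  a (x \- d) (x \- d) = a x x - 2 * a x d + a d d.
Proof.
move=> Vx Vd; have [sym _ _ _] := Ha.
rewrite scalar_productBl ?scalar_productBr ?(sym d x)//; [ring|exact: VB].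
Qed.

(** Pythagoras. *)
Lemma scalar_product_residual d r : V d -> V r -> a r (d \- r) = 0 ->
  a (d \- r) (d \- r) <= a d d.
Proof.
move=> Vd Vr; have [sym _ pos _] := Ha.
rewrite scalar_productBr// => H; rewrite scalar_product_polarization// (sym d r)//.
have := pos r Vr; lra.
Qed.
End scalar_product.

(** With X2, Y2, D2 the squared energies of x, y = x - d and d, and xd the
    product of x and d: completing the square in
    X2 = Y2 + 2 xd - D2 <= Y2 + 2 c sqrt D2 - D2 gives X2 <= Y2 + c ^ 2. *)
Lemma energy_estimate {R : realType} (X2 Y2 D2 xd c : R) : 0 <= Y2 -> 0 <= D2 ->
  0 <= c -> Y2 = X2 - 2 * xd + D2 -> xd <= c * Num.sqrt D2 ->
  2 / (1 + Num.sqrt 2) * Num.sqrt X2 <= Num.sqrt Y2 + c.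
Proof.
move=> Y0 D0 c0 YE xdc.
have s2 : 1 <= Num.sqrt (2 : R) by rewrite -{1}sqrtr1 ler_wsqrtr// ler1n.
apply: (@le_trans _ _ (Num.sqrt X2)).
  by rewrite ler_piMl ?sqrtr_ge0// ler_pdivrMr; lra.
rewrite -[leRHS]ger0_norm ?addr_ge0 ?sqrtr_ge0// -sqrtr_sqr ler_wsqrtr//.
have := sqr_sqrtr Y0; have := sqr_sqrtr D0.
have := sqrtr_ge0 Y2; move: xdc; set y := Num.sqrt Y2; set t := Num.sqrt D2.
move=> h1 h2 h3 h4; have := sqr_ge0 (t - c); have := mulr_ge0 h2 c0; nra.
Qed.

Lemma fsumr_le_subset {R : realType} (I : choiceType) (A B : set I) (F : I -> R) : finite_set B ->
  A `<=` B -> (forall i, 0 <= F i) -> \sum_(i \in A) F i <= \sum_(i \in B) F i.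
Proof.
move=> finB AB F0; rewrite (fsbigID A B)//= setIidr// lerDl.
by apply: fsumr_ge0 => i _.
Qed.

Section load.
Context {R : realType} {n : nat} (n_gt0 : (0 < n)%N) (Om : set 'rV[R]_n)
  (HOm : polyhedral_lipschitz_domain Om) {TT TTh : set (set 'rV[R]_n)}
  (HTT : regular_triangulation Om TT).
Local Notation mu := (lebesgue_rV n : {measure set 'rV[R]_n -> \bar R}).

(** On simplices common to both triangulations g vanishes; on the others
    Cauchy-Schwarz is applied first in L2 of the simplex, then to the sum. *)
Lemma load_residual_bound m (f g : 'rV[R]_n -> R) (L1 : R) : 0 <= L1 ->
  L2 Om f -> L2 Om g ->
  (forall T, TT T -> L2norm T g <= L1 * ediam T ^+ m * DNCnorm m TTh T g) ->
  (forall T, (TT `&` TTh) T -> ae_eq mu T g (cst 0)) ->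
  \int[mu]_(x in Om) (f x * g x) <=
  L1 * weighted_norm m (TT `\` TTh) f * norm_h m TT TTh g.
Proof.
move=> L0 [mf fi] [mg gi] C1 C3.
have mO := domain_measurable HOm.
have finT := triangulation_finite HTT.
have finD : finite_set (TT `\` TTh) by exact: finite_setD.
have mT T : TT T -> measurable T by exact: (triangulation_measurable n_gt0 HTT).
have fgi : mu.-integrable Om (EFin \o (f \* g)).
  by apply: integrable_mul => //; exact: measurable_funTS.
have mfg : measurable_fun setT (f \* g) by exact: measurable_funM.
have sq_int (h : 'rV[R]_n -> R) : measurable_fun setT h ->
    mu.-integrable Om (fun x => (h x ^+ 2)%:E) ->
    forall T, TT T -> mu.-integrable T (fun x => (h x ^+ 2)%:E).
  move=> mh ih T TTT; apply: (integrable_simplex n_gt0 HOm HTT) => //.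
  exact: measurable_funX.
rewrite (Rintegral_triangulation n_gt0 HOm HTT mfg fgi).
rewrite (fsbigID TTh)//= [X in X + _]fsbig1 ?add0r => [|T [TTT TTTh]]; last first.
  apply: ae_eq0_Rintegral; [exact: mT|exact: measurable_funTS|].
  have : ae_eq mu T g (cst 0) by exact: C3.
  by apply: filterS => x /[apply] /= ->; rewrite mulr0.
rewrite -setDE.
rewrite fsbig_finite//=.
apply: (@le_trans _ _ (\sum_(T <- finmap.enum_fset (fset_set (TT `\` TTh)))
    L1 * ((ediam T ^+ m * L2norm T f) * DNCnorm m TTh T g))).
  rewrite big_seq [leRHS]big_seq; apply: ler_sum => T.
  rewrite in_fset_set// inE => -[TTT _].
  apply: (@le_trans _ _ (L2norm T f * L2norm T g)).
    by apply: integral_CS; [exact: mT|exact: measurable_funTS|exact: measurable_funTS|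
      exact: sq_int|exact: sq_int].
  rewrite [leRHS](_ : _ = L2norm T f * (L1 * ediam T ^+ m * DNCnorm m TTh T g)); last by ring.
  by rewrite ler_wpM2l ?sqrtr_ge0// C1.
rewrite -mulr_sumr -mulrA ler_wpM2l//.
apply: le_trans (sum_CS _ _ _) _.
rewrite /weighted_norm /norm_h fsbig_finite//=.
under eq_bigr do rewrite exprMn -exprM mulnC.
rewrite ler_wpM2l ?sqrtr_ge0// ler_wsqrtr// -fsbig_finite//.
by apply: fsumr_le_subset => // T; exact: sqr_ge0.
Qed.

End load.

Theorem theorem3p1 (R : realType) (n m k : nat) (n_gt0 : (0 < n)%N)
    (m_gt0 : (0 < m)%N) (Om : set 'rV[R]_n)
    (HOm : polyhedral_lipschitz_domain Om)
    (TT TTh : set (set 'rV[R]_n))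
    (HTT : regular_triangulation Om TT)
    (HTTh : regular_triangulation Om TTh)
    (Href : refines TTh TT)
    (V Vh : set ('rV[R]_n -> R))
    (HV : is_subspace V) (HVP : V `<=` pw_poly k TT)
    (HVh : is_subspace Vh) (HVhP : Vh `<=` pw_poly k TTh)
    (Hah : is_scalar_product Om (sum_space V Vh) (a_h m TTh Om))
    (f : 'rV[R]_n -> R) (Hf : L2 Om f)
    (u uh : 'rV[R]_n -> R)
    (Hu : discrete_solution m TTh Om f V u)
    (Huh : discrete_solution m TTh Om f Vh uh)
    (I_h : ('rV[R]_n -> R) -> ('rV[R]_n -> R))
    (HI : linear_operator Om (sum_space (Hm0 m Om) Vh) V I_h)
    (L1 : R) (HL1 : 0 <= L1)
    (C1 : forall T vh, TT T -> Vh vh ->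
      L2norm T (vh \- I_h vh) <=
      L1 * ediam T ^+ m * DNCnorm m TTh T (vh \- I_h vh))
    (C2 : forall w vh, V w -> Vh vh -> a_h m TTh Om w (vh \- I_h vh) = 0)
    (C3 : forall T vh, (TT `&` TTh) T -> Vh vh ->
      ae_eq (lebesgue_rV n) T (vh \- I_h vh) (cst 0))
    (us : 'rV[R]_n -> R) (Hus : Vh us)
    (C4 : ae_eq (lebesgue_rV n) Om (I_h us) u) :
  2 / (1 + Num.sqrt 2) * norm_h m TT TTh (uh \- u) <=
  norm_h m TT TTh (us \- u) + L1 * weighted_norm m (TT `\` TTh) f.
Proof.
have [Vu uE] := Hu; have [Vuh uhE] := Huh.
have [VW VhW WB] := sum_space_linearP HV HVh.
have Vhd : Vh (uh \- us).
  rewrite (_ : uh \- us = fun x => -1 * us x + uh x); first by case: HVh => _; exact.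
  by apply/funext => x /=; ring.
pose d := uh \- us; pose r := I_h d.
(* d lies in the domain of I_h as the sum of 0 in Hm0 and d in Vh *)
have Vr : V r.
  have [IV _ _] := HI; apply: IV; exists (cst 0), d; split => //.
    by have [[? _ _ ?] _] := HOm; exact: Hm0_cst0.
  by apply/funext => x /=; rewrite add0r.
have pV v : V v -> pw_elementary TTh v.
  by move=> /HVP/pw_poly_elementary; exact: (pw_elementary_refines n_gt0 HTT HTTh Href).
have pVh v : Vh v -> pw_elementary TTh v.
  by move=> /HVhP/pw_poly_elementary.
have pB v w : pw_elementary TTh v -> pw_elementary TTh w ->
    pw_elementary TTh (v \- w).
  move=> pv pw; rewrite (_ : v \- w = fun x => -1 * w x + v x).
    exact: pw_elementary_lin.
  by apply/funext => x /=; ring.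
have nE v : pw_elementary TTh v ->
    norm_h m TT TTh v = Num.sqrt (a_h m TTh Om v v).
  exact: (norm_hE n_gt0 HOm HTT HTTh).
have L2e := pw_elementary_L2 n_gt0 HOm HTTh.
have fi v : pw_elementary TTh v ->
    (lebesgue_rV n).-integrable Om (EFin \o (f \* v)).
  move=> /L2e[mv iv]; have [mf if2] := Hf.
  apply: integrable_mul => //; [|exact: measurable_funTS..].
  exact: (domain_measurable HOm).
have [_ _ pos _] := Hah.
have Wd : sum_space V Vh d by exact: VhW.
have Wr : sum_space V Vh r by exact: VW.
have We : sum_space V Vh (uh \- u) by apply: WB; [exact: VhW|exact: VW].
(* Galerkin orthogonality: C2 trades d for r in the coarse problem *)
have residual_load : a_h m TTh Om (uh \- u) d =
    \int[lebesgue_rV n]_(x in Om) (f x * (d x - r x)).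
  have := C2 u d Vu Vhd; rewrite -/r (scalar_productBr Hah)//; last exact: VW.
  move=> /eqP; rewrite subr_eq0 => /eqP udr.
  rewrite (scalar_productBl Hah)//; [|exact: VhW|exact: VW].
  rewrite udr uhE// uE// -RintegralB; first last.
  - exact: fi (pV _ Vr).
  - exact: fi (pVh _ Vhd).
  - exact: (domain_measurable HOm).
  by apply: eq_Rintegral => x _; rewrite [RHS]mulrBr.
rewrite !nE; [|by apply: pB; [exact: pVh|exact: pV]..].
apply: (energy_estimate (D2 := a_h m TTh Om d d) (xd := a_h m TTh Om (uh \- u) d)).
- by apply: pos; apply: WB; [exact: VhW|exact: VW].
- exact: pos.
- by rewrite mulr_ge0// sqrtr_ge0.
- rewrite -(scalar_product_polarization Hah)//.
  rewrite (_ : (uh \- u) \- d = us \- u)//.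
  by apply/funext => x /=; rewrite /d /=; ring.
rewrite residual_load; apply: le_trans (load_residual_bound n_gt0 HOm HTT (TTh := TTh)
  (m := m) HL1 Hf (L2e _ (pB _ _ (pVh _ Vhd) (pV _ Vr))) _ _) _.
- by move=> T TTT; exact: C1.
- by move=> T TTT; exact: C3.
rewrite ler_wpM2l ?mulr_ge0 ?sqrtr_ge0// nE; last by apply: pB; [exact: pVh|exact: pV].
by rewrite ler_wsqrtr//; apply: (scalar_product_residual Hah) => //; exact: C2.
Qed.
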